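(* Let $k\ge 1$ be an integer and let $\mathfrak X$ be a topological space. The chain map $$\mathrm S(\mathfrak X)\to \mathrm S^{(k)}(\mathfrak X)$$ from the singular (simplicial) chains to the $k$-fold singular chains of $\mathfrak X$, defined by precomposing a continuous map $(\mathbb{\Delta}^n\to\mathfrak X)$ with the projection $$\mathbb{\Delta}^n\times\mathbb{\Delta}^0\times\cdots\times\mathbb{\Delta}^0\xrightarrow{\pi_1}\mathbb{\Delta}^n,$$ is a quasi-isomorphism of $E_\infty$-coalgebras (that is, a morphism of $U\mathcal M$-coalgebras inducing an isomorphism in homology).
   Context: Fix a commutative unital ground ring $\Bbbk$; chain complexes are of $\Bbbk$-modules, with the Koszul sign convention. Multisimplicial sets. A $k$-fold multisimplicial set is a functor $X\colon (\triangle^{\times k})^{op}\to\mathsf{Set}$, where $\triangle$ is the simplex category. Write $X_{n_1,\dots,n_k}=X([n_1]\times\cdots\times[n_k])$; its elements are $(n_1,\dots,n_k)$-multisimplices, with face maps $d^j_i$ and degeneracy maps $s^j_i$ in direction $j$. A multisimplex is degenerate if it is in the image of some $s^j_i$. The representable ones are denoted $\triangle^{n_1,\dots,n_k}$. For $k=1$ these are simplicial sets. Chains. $\mathrm{N}(X)_n$ is freely generated by the non-degenerate $(n_1,\dots,n_k)$-multisimplices with $n_1+\dots+n_k=n$ (degenerate ones being $0$), with differential $\partial x=\sum_{j=1}^k\sum_{\ell=0}^{n_j}(-1)^{n_1+\dots+n_{j-1}+\ell}\,d^j_\ell(x)$. Then $\mathrm{N}(\triangle^{n_1,\dots,n_k})=\mathrm{N}(\triangle^{n_1})\otimes\cdots\otimes\mathrm{N}(\triangle^{n_k})$.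 Singular multisimplicial sets. $\mathbb{\Delta}^n$ is the topological $n$-simplex $\{(t_1,\dots,t_n)\in[0,1]^n\mid t_1\ge\dots\ge t_n\}$ with its usual cosimplicial structure. $\mathrm{Sing}^{(k)}(\mathfrak X)$ is the $k$-fold multisimplicial set with $\mathrm{Sing}^{(k)}(\mathfrak X)_{n_1,\dots,n_k}=\mathsf{Top}(\mathbb{\Delta}^{n_1}\times\cdots\times\mathbb{\Delta}^{n_k},\mathfrak X)$; $\mathrm S^{(k)}(\mathfrak X)=\mathrm N\,\mathrm{Sing}^{(k)}(\mathfrak X)$ is the complex of $k$-fold singular chains, and $\mathrm S(\mathfrak X)=\mathrm S^{(1)}(\mathfrak X)$. $\mathcal M$-bialgebras and $U\mathcal M$-coalgebras. An $\mathcal M$-bialgebra is a counital coalgebra $(C,\Delta,\epsilon)$ (chain maps with $(\mathrm{id}\otimes\epsilon)\Delta=\mathrm{id}=(\epsilon\otimes\mathrm{id})\Delta$) with a degree $1$ linear map $\ast\colon C\otimes C\to C$ satisfying $\epsilon(c_1\ast c_2)=0$ and $\partial(c_1\ast c_2)+\partial c_1\ast c_2+(-1)^{|c_1|}c_1\ast\partial c_2=\epsilon(c_1)c_2-\epsilon(c_2)c_1$. Equivalently, it is an algebra over the differential graded prop $\mathcal M$ generated by $\Delta$ (arity $1\to2$, degree $0$), $\epsilon$ (arity $1\to 0$, degree $0$), $\ast$ (arity $2\to1$, degree $1$), with relations $(\mathrm{id}\otimes\epsilon)\Delta=\mathrm{id}=(\epsilon\otimes\mathrm{id})\Delta$, $\epsilon\circ\ast=0$,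 and differential $\partial\Delta=0$, $\partial\epsilon=0$, $\partial\ast=\epsilon\otimes\mathrm{id}-\mathrm{id}\otimes\epsilon$. The operad $U\mathcal M$ has $U\mathcal M(r)=\mathcal M(1,r)$ (one input, $r$ outputs); it is known to be an $E_\infty$-operad. A $U\mathcal M$-coalgebra is a chain complex $C$ with an operad map from $U\mathcal M$ to the operad $\{\mathrm{Hom}(C,C^{\otimes r})\}_r$; here ''$E_\infty$-coalgebra'' means $U\mathcal M$-coalgebra. Every $\mathcal M$-bialgebra is a $U\mathcal M$-coalgebra. The structure on chains. On $\mathrm{N}(\triangle^n)$: $\Delta[v_0,\dots,v_m]=\sum_{i=0}^m[v_0,\dots,v_i]\otimes[v_i,\dots,v_m]$; $\epsilon[v_0,\dots,v_q]=1$ if $q=0$ and $0$ if $q>0$; and $[v_0,\dots,v_p]\ast[v_{p+1},\dots,v_q]=(-1)^p\,\mathrm{sign}(\pi)\,[v_{\pi(0)},\dots,v_{\pi(q)}]$ if all $v_i$ are distinct, where $\pi$ is the permutation ordering the vertices, and $0$ otherwise. On $\mathrm{N}(\triangle^{n_1})\otimes\cdots\otimes\mathrm{N}(\triangle^{n_k})$: $\Delta$ and $\epsilon$ are those of the tensor product of counital coalgebras, and $$(x_1\otimes\cdots\otimes x_k)\ast(y_1\otimes\cdots\otimes y_k)=\sum_{i=1}^k(-1)^{|x_{<i}|}\,x_{<i}\,\epsilon(y_{<i})\otimes (x_i\ast y_i)\otimes\epsilon(x_{>i})\,y_{>i},$$ where $z_{<i}=z_1\otimes\cdots\otimes z_{i-1}$,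 $z_{>i}=z_{i+1}\otimes\cdots\otimes z_k$. This makes $\mathrm{N}(\triangle^{n_1,\dots,n_k})$ a natural $\mathcal M$-bialgebra, hence a natural $U\mathcal M$-coalgebra. For general $X$, $x\in X_{n_1,\dots,n_k}$ with characteristic map $\xi\colon\triangle^{n_1,\dots,n_k}\to X$ and $p\in U\mathcal M(r)$, set $p(x)=\mathrm{N}(\xi)^{\otimes r}\,p\big([0,\dots,n_1]\otimes\cdots\otimes[0,\dots,n_k]\big)$. *)

(* Defs.v *)
From HB Require Import structures.
From mathcomp Require Import all_boot all_order all_algebra.
From mathcomp Require Import all_classical all_reals all_analysis.
Import numFieldNormedType.Exports.
Import Order.TTheory GRing.Theory Num.Theory.

Set Implicit Arguments.
Unset Strict Implicit.
Unset Printing Implicit Defensive.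

Local Open Scope classical_set_scope.
Local Open Scope quotient_scope.
Local Open Scope ring_scope.

(** * Free modules *)

Section FreeModule.
Variables (K : comPzRingType) (B : choiceType).

Definition fin_supp : {pred B -> K^o} :=
  [pred c : B -> K^o | `[< finite_set [set b | c b != 0] >]].

Lemma fin_supp_submod : submod_closed fin_supp.
Proof.
split=> [|a u v]; rewrite !inE.
  by apply: sub_finite_set (@finite_set0 B) => b /=; rewrite eqxx.
move=> fu fv.
have fuv : finite_set ([set b | u b != 0] `|` [set b | v b != 0]).
  by rewrite finite_setU.
apply: sub_finite_set fuv => b /= nz; apply: contrapT => /not_orP[/negP + /negP].
rewrite !negbK => /eqP u0 /eqP v0; move/eqP: nz; apply.
rewrite [LHS](_ : _ = a *: u b + v b) // u0 v0.
by rewrite scaler0 addr0.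
Qed.

HB.instance Definition _ := GRing.isSubmodClosed.Build K (B -> K^o) fin_supp
  fin_supp_submod.

Record freemod := Free { coef :> B -> K^o; coefP : coef \in fin_supp }.
HB.instance Definition _ := [isSub for coef].
HB.instance Definition _ := [Choice of freemod by <:].
HB.instance Definition _ := [SubChoice_isSubLmodule of freemod by <:].

Lemma delta_subproof (b : B) : (fun b' => (b' == b)%:R : K^o) \in fin_supp.
Proof.
rewrite inE; apply: sub_finite_set (finite_set1 b) => b'.
by rewrite /=; case: (eqVneq b' b) => [->|] //=; rewrite mulr0n eqxx.
Qed.

Definition fdelta b : freemod := Free (delta_subproof b).

(* The linear extension of phi; the sum runs over the (finite) support of c. *)
Definition flin (V : lmodType K) (phi : B -> V) (c : freemod) : V :=
  \sum_(b \in [set: B]) c b *: phi b.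

Lemma flin_sum (V : lmodType K) (phi : B -> V) (c : freemod) (A : set B) :
    finite_set A -> (forall b, c b != 0 -> A b) ->
  flin phi c = \sum_(b \in A) c b *: phi b.
Proof.
move=> fA cA; rewrite /flin; apply/esym/fsbig_widen => // b /= [_ nAb].
rewrite (_ : c b = 0) ?scale0r //.
by apply/eqP; apply: contra_notT nAb; exact: cA.
Qed.

Lemma coefD a (u v : freemod) b : (a *: u + v) b = a * u b + v b.
Proof. by []. Qed.

Lemma flin_is_linear (V : lmodType K) (phi : B -> V) : linear (flin phi).
Proof.
move=> a u v.
have /asboolP fu := coefP u; have /asboolP fv := coefP v.
pose A := [set b | u b != 0] `|` [set b | v b != 0].
have fA : finite_set A by rewrite finite_setU.
have uA b : u b != 0 -> A b by left.
have vA b : v b != 0 -> A b by right.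
have uvA b : (a *: u + v) b != 0 -> A b.
  move=> nz; apply: contrapT => /not_orP[/negP + /negP].
  rewrite !negbK => /eqP u0 /eqP v0; move/eqP: nz; apply.
  by rewrite coefD u0 v0 mulr0 addr0.
rewrite (flin_sum phi fA uA) (flin_sum phi fA vA) (flin_sum phi fA uvA).
rewrite !fsbig_finite //= scaler_sumr -big_split /=.
by apply: eq_bigr => b _; rewrite scalerA -scalerDl.
Qed.

HB.instance Definition _ (V : lmodType K) (phi : B -> V) :=
  GRing.isLinear.Build K freemod V *:%R (flin phi) (flin_is_linear phi).

Lemma flin_delta (V : lmodType K) (phi : B -> V) b : flin phi (fdelta b) = phi b.
Proof.
rewrite (flin_sum phi (finite_set1 b)) ?fsbig_set1 /= ?eqxx ?scale1r // => b'.
by rewrite /=; case: (eqVneq b' b) => [->|] //=; rewrite mulr0n eqxx.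
Qed.

End FreeModule.

Arguments fdelta {K B} b.

(** * Based chain complexes and their tensor powers *)

(* A complex of free modules with a chosen homogeneous basis. *)
Record bcomplex (K : comPzRingType) := BComplex {
  cbasis : choiceType;
  bdeg : cbasis -> nat;
  bdiff : cbasis -> freemod K cbasis }.

Section Complex.
Variables (K : comPzRingType) (C : bcomplex K).

Definition chain := freemod K (cbasis C).

(* C^{(x) r} is the span, inside the tensor algebra, of the words of length r. *)
Definition tens := freemod K (seq (cbasis C)).

Definition bnd : chain -> chain := flin (@bdiff K C).

Definition homog (n : nat) (c : chain) : Prop :=
  forall b, c b != 0 -> bdeg b = n.

Definition is_cycle n : {pred chain} :=
  [pred c : chain | `[< homog n c /\ bnd c = 0 >]].

Lemma cycle_zmod n : zmod_closed (is_cycle n).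
Proof.
split=> [|u v]; rewrite !inE; first by split=> [b|];
  [rewrite eqxx|rewrite /bnd linear0].
move=> [hu cu] [hv cv].
split; last by rewrite /bnd linearB /= -/(bnd u) -/(bnd v) cu cv subrr.
move=> b; rewrite (_ : (u - v) b = u b - v b) //.
case: (eqVneq (u b) 0) => [->|/hu//]; case: (eqVneq (v b) 0) => [->|/hv//].
by rewrite subrr eqxx.
Qed.

HB.instance Definition _ n := GRing.isZmodClosed.Build chain (is_cycle n)
  (cycle_zmod n).

Record cycle n := Cycle { cval : chain; cvalP : cval \in is_cycle n }.
HB.instance Definition _ n := [isSub for @cval n].
HB.instance Definition _ n := [Choice of cycle n by <:].
HB.instance Definition _ n := [SubChoice_isSubZmodule of cycle n by <:].

Definition is_bound n : {pred cycle n} :=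
  [pred z : cycle n | `[< exists2 b, homog n.+1 b & bnd b = cval z >]].

Lemma bound_zmod n : zmod_closed (@is_bound n).
Proof.
split=> [|u v]; rewrite !inE.
  by exists 0; [move=> b; rewrite eqxx|rewrite /bnd linear0].
move=> [b hb eb] [c hc ec]; exists (b - c).
  move=> x; rewrite (_ : (b - c) x = b x - c x) //.
  case: (eqVneq (b x) 0) => [->|/hb//]; case: (eqVneq (c x) 0) => [->|/hc//].
  by rewrite subrr eqxx.
by rewrite /bnd linearB /= -/(bnd b) -/(bnd c) eb ec.
Qed.

HB.instance Definition _ n := GRing.isZmodClosed.Build (cycle n) (@is_bound n)
  (@bound_zmod n).

Definition homology n := Quotient.quot (@is_bound n).

End Complex.

Arguments is_cycle {K} C n c.

Section ChainMaps.
Variables (K : comPzRingType) (C D : bcomplex K).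

Record chain_map (f : chain C -> chain D) : Prop := ChainMap {
  chain_map_linear : linear f;
  chain_map_homog : forall n c, homog n c -> homog n (f c);
  chain_map_bnd : forall c, bnd (f c) = f (bnd c) }.

Lemma cycle_map_subproof f (hf : chain_map f) n (z : cycle C n) :
  f (cval z) \in is_cycle D n.
Proof.
case: z => z /=; rewrite !inE => -[hz cz]; split.
  exact: chain_map_homog.
rewrite (chain_map_bnd hf) cz.
by have := chain_map_linear hf (-1) 0 0; rewrite scaler0 addr0 scaleN1r addNr.
Qed.

Definition cycle_map f (hf : chain_map f) n (z : cycle C n) : cycle D n :=
  Cycle (cycle_map_subproof hf z).

Definition homology_map f (hf : chain_map f) n (h : homology C n) :
  homology D n := \pi_(homology D n) (cycle_map hf (repr h)).

Definition quasi_iso (f : chain C -> chain D) : Prop :=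
  exists hf : chain_map f, forall n, bijective (homology_map hf (n := n)).

End ChainMaps.

Definition tmul (K : comPzRingType) (B : choiceType) (s t : freemod K (seq B)) :
    freemod K (seq B) :=
  flin (fun u => flin (fun v => fdelta (u ++ v)) t) s.

(* phi^{(x) r} for all r at once, phi : K[B] -> K[B'] being given on B. *)
Definition tpow (K : comPzRingType) (B B' : choiceType) (phi : B -> freemod K B') :
    freemod K (seq B) -> freemod K (seq B') :=
  flin (fun w => foldr
    (fun b t => tmul (flin (fun b' => fdelta [:: b']) (phi b)) t)
    (fdelta [::]) w).

(** * Multisimplicial sets and their normalized chains *)

(* A monotone map [m] -> [n] is encoded by the sequence of its m + 1 values; a
   morphism [m_1] x ... x [m_k] -> [n_1] x ... x [n_k] by k such sequences. *)
Section MultiSimplex.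
Variable k : nat.
Local Notation idx := {ffun 'I_k -> nat}.
Local Notation mmap := {ffun 'I_k -> seq nat}.

Definition mhom (m n : idx) (t : mmap) : bool :=
  [forall j, [&& size (t j) == (m j).+1, sorted leq (t j) &
                 all (fun i => i <= n j)%N (t j)]].

Definition mid (n : idx) : mmap := [ffun j => iota 0 (n j).+1].

Definition mcomp (t s : mmap) : mmap :=
  [ffun j => [seq nth 0%N (t j) i | i <- s j]].

Record mset := MSet {
  msimp : idx -> choiceType;
  mpull : forall m n t, mhom m n t -> msimp n -> msimp m;
  mpull_id : forall n (h : mhom n n (mid n)) x, mpull h x = x;
  mpull_comp : forall l m n s t (hs : mhom l m s) (ht : mhom m n t)
    (hts : mhom l n (mcomp t s)) x, mpull hts x = mpull hs (mpull ht x) }.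

(* d^j_i is the action of mface n j i; no such morphism exists if n_j = 0. *)
Definition mface (n : idx) (j : 'I_k) (i : nat) : mmap :=
  [ffun j' => if j' == j then rem i (iota 0 (n j').+1) else iota 0 (n j').+1].

(* s^j_i is the action of mdegen n j i, whose values in direction j are
   0, ..., i, i, ..., n_j. *)
Definition mdegen (n : idx) (j : 'I_k) (i : nat) : mmap :=
  [ffun j' => if j' == j then iota 0 i.+1 ++ iota i ((n j').+1 - i)
              else iota 0 (n j').+1].

Section Chains.
Variables (K : comPzRingType) (X : mset).

Definition multisimplex : choiceType := {n : idx & msimp X n}.

Definition degenerate (x : multisimplex) : Prop :=
  exists (n : idx) (j : 'I_k) (i : nat), (i <= n j)%N /\
  exists (h : mhom (tag x) n (mdegen n j i)) (y : msimp X n),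
    tagged x = mpull h y.

Record nondeg := NonDeg { nval : multisimplex; _ : ~~ `[< degenerate nval >] }.
HB.instance Definition _ := [isSub for nval].
HB.instance Definition _ := [Choice of nondeg by <:].

(* The generator of N(X) given by x, which is 0 if x is degenerate. *)
Definition ngen (x : multisimplex) : freemod K nondeg := oapp fdelta 0 (insub x).

(* N(xi)(t), for xi the characteristic map of x and t a multisimplex of its
   source; it is 0 if t is not a multisimplex there. *)
Definition char_map (x : multisimplex) (t : mmap) : freemod K nondeg :=
  let m : idx := [ffun j => (size (t j)).-1] in
  if @idP (mhom m (tag x) t) is ReflectT h
  then ngen (Tagged (fun n => msimp X n) (mpull h (tagged x))) else 0.

Definition mdim (n : idx) : nat := (\sum_j n j)%N.

Definition ndiff (b : nondeg) : freemod K nondeg :=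
  let n := tag (nval b) in
  \sum_(j < k) \sum_(l < (n j).+1)
    (-1) ^+ ((\sum_(i < k | (i < j)%N) n i) + l) *:
    char_map (nval b) (mface n j l).

Definition nchains : bcomplex K :=
  {| cbasis := nondeg; bdeg := fun b => mdim (tag (nval b)); bdiff := ndiff |}.

End Chains.
End MultiSimplex.

(** * Singular multisimplices *)

Section Singular.
Variable R : realType.

Definition simplex (n : nat) : set 'rV[R]_n :=
  [set t | (forall i, 0 <= t ord0 i <= 1) /\
           (forall i j : 'I_n, (i <= j)%N -> t ord0 j <= t ord0 i)].

Arguments simplex n t : clear implicits.

(* t_0 = 1, t_1, ..., t_n, t_{n+1} = 0 *)
Definition tcoord n (t : 'rV[R]_n) (i : nat) : R :=
  if i is i'.+1 then oapp (t ord0) 0 (insub i') else 1.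

(* The map of simplices induced by the monotone map [m] -> [n] with values s:
   its j-th coordinate is t_i for i the least element with j <= s_i. *)
Definition spush n m (s : seq nat) (t : 'rV[R]_m) : 'rV[R]_n :=
  \row_j tcoord t (count (fun v => v < j.+1)%N s).

Lemma push_subproof n m s (t : simplex m) :
  spush n s (val t) \in simplex n.
Proof.
have /set_mem[t01 tdec] := valP t.
have c01 i : 0 <= tcoord (val t) i <= 1.
  case: i => [|i] /=; first by rewrite ler01 lexx.
  by case: insubP => [u _ _|_] /=; rewrite ?lexx ?ler01.
have cdec i j : (i <= j)%N -> tcoord (val t) j <= tcoord (val t) i.
  case: i j => [|i] [|j] //= ij; first by have /andP[] := c01 j.+1.
  case: insubP => [j' _ ej|_] /=; last by have /andP[] := c01 i.+1.
  case: insubP => [i' _ ei|] /=; first by apply: tdec; rewrite ei ej.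
  by rewrite -leqNgt => mi; move: (ltn_ord j'); rewrite ej ltnNge (leq_trans mi).
apply/mem_set; split=> [i|i j ij]; rewrite !mxE //; apply: cdec.
by apply: sub_count => v /= /leq_trans; apply.
Qed.

Definition simplex_map n m s (t : simplex m) : simplex n :=
  exist _ (spush n s (val t)) (push_subproof n s t).

Lemma continuous_row (T : topologicalType) n (f : T -> 'rV[R]_n) :
  (forall j, continuous (fun x => f x ord0 j)) -> continuous f.
Proof.
move=> fc x U [P Px PU]; apply: (filterS PU).
have : \forall y \near x, forall i j, P i j (f y i j).
  apply: filter_forall => i; apply: filter_forall => j.
  by rewrite (ord1 i) in Px *; apply: (fc j x); rewrite -(ord1 ord0); exact: Px.
by apply: filterS.
Qed.

Lemma simplex_map_continuous n m s : continuous (@simplex_map n m s).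
Proof.
apply: continuous_comp_initial; apply: continuous_row => j.
rewrite (_ : (fun _ => _) =
  fun t : simplex m => tcoord (val t) (count (fun v => v < j.+1)%N s)).
  case: (count _ _) => [|i] /=; first exact: cst_continuous.
  case: insubP => [u _ _|_] /=; last exact: cst_continuous.
  move=> t; apply: (@continuous_comp _ _ _ (fun t : simplex m => val t)
    (fun v : 'rV[R]_m => v ord0 u)); first exact: initial_continuous.
  exact: coord_continuous.
by apply/funext => t; rewrite /= mxE.
Qed.

Lemma count_lt_nth (s : seq nat) (i c : nat) :
  sorted leq s -> (i < size s)%N ->
  (nth 0 s i < c)%N = (i < count (fun v => v < c)%N s)%N.
Proof.
elim: s i => // a s IHs i /= pas.
have c0 : (c <= a)%N -> count (fun v => v < c)%N s = 0%N.
  move=> ca; apply/eqP; rewrite -leqn0 leqNgt -has_count -all_predC.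
  have := order_path_min leq_trans pas; apply: sub_all => v av /=.
  by rewrite -leqNgt (leq_trans ca).
case: i => [|i] si /=.
  by case: (ltnP a c) => [|/c0 ->].
rewrite IHs ?(path_sorted pas) //.
by case: (ltnP a c) => [_|/c0 ->]; rewrite ?add1n ?ltnS.
Qed.

Lemma tcoord_push n m s (t : 'rV[R]_m) (c : nat) :
  sorted leq s -> size s = m.+1 -> all (fun i => i <= n)%N s ->
  tcoord (spush n s t) c = tcoord t (count (fun v => v < c)%N s).
Proof.
move=> ss sm sn; case: c => [|c] /=.
  by rewrite (eq_count (a2 := pred0)) ?count_pred0.
case: insubP => [u _ <-|]; rewrite /= ?mxE // -leqNgt => nc.
rewrite (_ : count _ s = m.+1) /=.
  by case: insubP => //= u; rewrite ltnn.
rewrite -sm; apply/eqP; rewrite -all_count.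
by apply: sub_all sn => v vn; rewrite ltnS (leq_trans vn).
Qed.

Variable k : nat.
Local Notation idx := {ffun 'I_k -> nat}.
Local Notation mmap := {ffun 'I_k -> seq nat}.

Definition prod_simplex (n : idx) : topologicalType :=
  prod_topology (fun j => simplex (n j)).

Definition prod_simplex_map (n m : idx) (s : mmap) (t : prod_simplex m) :
  prod_simplex n := fun j => simplex_map (n j) (s j) (t j).

Lemma continuous_prod (T : topologicalType) (I : Type)
    (U : I -> topologicalType) (f : T -> prod_topology U) :
  (forall j, continuous (fun x => f x j)) -> continuous f.
Proof.
move=> fc x; apply/cvg_sup => j.
by apply: (@continuous_comp_initial _ T (U j) (@proj _ U j) f); exact: fc.
Qed.

Lemma prod_simplex_map_continuous n m s :
  continuous (@prod_simplex_map n m s).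
Proof.
apply: continuous_prod => j t.
apply: (@continuous_comp _ _ _ (fun t : prod_simplex m => t j)
  (simplex_map (n j) (s j))); last exact: simplex_map_continuous.
exact: (@proj_continuous _ (fun j => simplex (m j)) j).
Qed.

Lemma prod_simplex_map_id n (t : prod_simplex n) :
  prod_simplex_map n (mid n) t = t.
Proof.
apply: functional_extensionality_dep => j; apply: val_inj => /=.
apply/rowP => i; rewrite mxE ffunE.
have -> : count (fun v => v < i.+1)%N (iota 0 (n j).+1) = i.+1.
  by rewrite -size_filter (@filter_iota_ltn 0) ?size_iota //; apply: leqW.
rewrite /tcoord insubT //= => ?.
by congr (_ _ _); apply: val_inj.
Qed.

Lemma prod_simplex_map_comp l m n (s t : mmap) (u : prod_simplex l) :
  mhom l m s -> mhom m n t ->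
  prod_simplex_map n (mcomp t s) u =
  prod_simplex_map n t (prod_simplex_map m s u).
Proof.
move=> /forallP hs /forallP ht.
apply: functional_extensionality_dep => j; apply: val_inj => /=.
apply/rowP => i; rewrite !mxE ffunE.
have /and3P[/eqP ss so sa] := hs j; have /and3P[/eqP ts to ta] := ht j.
rewrite tcoord_push //; congr (tcoord _ _).
rewrite count_map; apply: eq_in_count => v vs /=.
have vm : (v < size (t j))%N by rewrite ts ltnS; apply: (allP sa).
exact: count_lt_nth.
Qed.

Variable T : topologicalType.

Definition sing_pull (m n : idx) (s : mmap) (_ : mhom m n s)
    (x : continuousType (prod_simplex n) T) :
  continuousType (prod_simplex m) T :=
  x \o mkcts (@prod_simplex_map_continuous n m s).

Lemma sing_pull_id n (h : mhom n n (mid n)) x : sing_pull h x = x.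
Proof. by apply/continuousEP => t /=; rewrite /mkcts prod_simplex_map_id. Qed.

Lemma sing_pull_comp l m n s t (hs : mhom l m s) (ht : mhom m n t)
    (hts : mhom l n (mcomp t s)) x :
  sing_pull hts x = sing_pull hs (sing_pull ht x).
Proof.
by apply/continuousEP => u /=; rewrite /mkcts (prod_simplex_map_comp _ hs ht).
Qed.

Definition sing : mset k := {|
  msimp n := continuousType (prod_simplex n) T;
  mpull := sing_pull;
  mpull_id := sing_pull_id;
  mpull_comp := sing_pull_comp |}.

End Singular.

Arguments simplex R n t : clear implicits.

(** * The projection Delta^n x Delta^0 x ... x Delta^0 -> Delta^n *)

Section Projection.
Variables (K : comPzRingType) (R : realType) (k : nat) (k_gt0 : (0 < k)%N).
Variable T : topologicalType.

Definition dir1 : 'I_k := Ordinal k_gt0.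

Definition proj_idx (n : {ffun 'I_1 -> nat}) : {ffun 'I_k -> nat} :=
  [ffun j => if j == dir1 then n ord0 else 0%N].

(* Pushing along the identity vertex map only serves to identify the factor
   simplex (proj_idx n dir1) with simplex (n ord0). *)
Definition pi1 (n : {ffun 'I_1 -> nat}) (t : prod_simplex R (proj_idx n)) :
    prod_simplex R n :=
  fun j => simplex_map (n j) (iota 0 (n j).+1) (t dir1).

Lemma pi1_continuous n : continuous (@pi1 n).
Proof.
apply: continuous_prod => j t.
apply: (@continuous_comp _ _ _ (fun t : prod_simplex R (proj_idx n) => t dir1)
  (simplex_map (n j) (iota 0 (n j).+1))); last exact: simplex_map_continuous.
exact: (@proj_continuous _ (fun j => simplex R (proj_idx n j)) dir1).
Qed.

Definition proj_simp (x : multisimplex (sing R 1 T)) : multisimplex (sing R k T) :=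
  existT (msimp (sing R k T)) (proj_idx (tag x))
    ((tagged x : continuousType _ _) \o mkcts (@pi1_continuous (tag x))
     : continuousType _ _).

Definition proj_chain :
    chain (nchains K (sing R 1 T)) -> chain (nchains K (sing R k T)) :=
  flin (fun x => ngen K (proj_simp (nval x))).

End Projection.

(** * The operations on chains of products of standard simplices *)

(* The face [v_0, ..., v_m] of a standard simplex is the increasing sequence of
   its vertices, and the generator x_1 (x) ... (x) x_k of
   N(Delta^{n_1}) (x) ... (x) N(Delta^{n_k}) is the sequence of the x_i.  No
   operation below creates a vertex, so the bounds n_i are left out. *)
Definition cell := seq (seq nat).

Section Operations.
Variable K : comPzRingType.

Definition vdim (v : seq nat) : nat := (size v).-1.

Definition cdim (x : cell) : nat := sumn [seq vdim v | v <- x].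

(* The tensor product of Alexander-Whitney coproducts; the sign comes from the
   exchange of the right factor of x_1 with the left factor of the rest. *)
Fixpoint coprod (x : cell) : freemod K (cell * cell)%type :=
  if x is v :: x' then
    \sum_(i < size v)
      flin (fun ab : cell * cell => (-1) ^+ (vdim (drop i v) * cdim ab.1) *:
        fdelta (take i.+1 v :: ab.1, drop i v :: ab.2)) (coprod x')
  else fdelta ([::], [::]).

Definition veps (v : seq nat) : K := (vdim v == 0%N)%:R.

Definition ceps (x : cell) : K := \prod_(v <- x) veps v.

Definition inversions (s : seq nat) : nat :=
  (\sum_(b < size s) \sum_(a < b) (nth 0 s b < nth 0 s a))%N.

(* The number of inversions of a sequence of distinct vertices has the parity
   of the permutation which orders it. *)
Definition vjoin (v w : seq nat) : freemod K (seq nat) :=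
  if uniq (v ++ w) then
    (-1) ^+ (vdim v) *: ((-1) ^+ inversions (v ++ w) *:
      fdelta (sort leq (v ++ w)))
  else 0.

Definition cjoin (x y : cell) : freemod K cell :=
  \sum_(i < size x)
    ((-1) ^+ cdim (take i x) * ceps (take i y) * ceps (drop i.+1 x)) *:
    flin (fun z => fdelta (take i x ++ z :: drop i.+1 y))
      (vjoin (nth [::] x i) (nth [::] y i)).

End Operations.

(** * The prop M and the operad UM *)

(* Formal expressions for the (homogeneous) morphisms of the free symmetric
   monoidal linear category on the generators; mswap m n exchanges m and n
   strands, mzero m n d is the zero of M(m, n)_d. *)
Inductive mterm (K : Type) : Type :=
| mone of nat
| mswap of nat & nat
| mcop
| mcou
| mjoin
| mafter of mterm K & mterm K
| mtens of mterm K & mterm K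
| mzero of nat & nat & nat
| madd of mterm K & mterm K
| mscale of K & mterm K.

Arguments mone {K}. Arguments mswap {K}. Arguments mcop {K}.
Arguments mcou {K}. Arguments mjoin {K}. Arguments mzero {K}.

HB.instance Definition _ (K : Type) := gen_eqMixin (mterm K).
HB.instance Definition _ (K : Type) := gen_choiceMixin (mterm K).

Section Prop_M.
Variable K : comPzRingType.
Local Notation term := (mterm K).

Fixpoint tin (t : term) : nat :=
  match t with
  | mone n => n
  | mswap m n => m + n
  | mcop => 1
  | mcou => 1
  | mjoin => 2
  | mafter _ f => tin f
  | mtens f g => tin f + tin g
  | mzero m _ _ => m
  | madd f _ => tin f
  | mscale _ f => tin f
  end%N.

Fixpoint tout (t : term) : nat :=
  match t with
  | mone n => n
  | mswap m n => n + m
  | mcop => 2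
  | mcou => 0
  | mjoin => 1
  | mafter g _ => tout g
  | mtens f g => tout f + tout g
  | mzero _ n _ => n
  | madd f _ => tout f
  | mscale _ f => tout f
  end%N.

Fixpoint tdeg (t : term) : nat :=
  match t with
  | mone _ => 0
  | mswap _ _ => 0
  | mcop => 0
  | mcou => 0
  | mjoin => 1
  | mafter g f => tdeg g + tdeg f
  | mtens f g => tdeg f + tdeg g
  | mzero _ _ d => d
  | madd f _ => tdeg f
  | mscale _ f => tdeg f
  end%N.

Definition same_type (s t : term) : bool :=
  [&& tin s == tin t, tout s == tout t & tdeg s == tdeg t].

Fixpoint well_formed (t : term) : bool :=
  match t with
  | mafter g f => [&& well_formed g, well_formed f & tin g == tout f]
  | mtens f g => well_formed f && well_formed g
  | madd f g => [&& well_formed f, well_formed g & same_type f g]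
  | mscale _ f => well_formed f
  | _ => true
  end.

Definition has_type (m n d : nat) (t : term) : bool :=
  [&& well_formed t, tin t == m, tout t == n & tdeg t == d].

Local Notation zero_like f := (mzero (tin f) (tout f) (tdeg f)).

(* The axioms of K-linear graded props, followed by the relations of M. *)
Inductive prop_rel : term -> term -> Prop :=
| rel_addA f g h : prop_rel (madd f (madd g h)) (madd (madd f g) h)
| rel_addC f g : prop_rel (madd f g) (madd g f)
| rel_add0 f : prop_rel (madd f (zero_like f)) f
| rel_addN f : prop_rel (madd f (mscale (-1) f)) (zero_like f)
| rel_scaleA a b f : prop_rel (mscale a (mscale b f)) (mscale (a * b) f)
| rel_scale1 f : prop_rel (mscale 1 f) f
| rel_scaleDr a f g :
    prop_rel (mscale a (madd f g)) (madd (mscale a f) (mscale a g))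
| rel_scaleDl a b f :
    prop_rel (mscale (a + b) f) (madd (mscale a f) (mscale b f))
| rel_afterDl f g h :
    prop_rel (mafter (madd f g) h) (madd (mafter f h) (mafter g h))
| rel_afterDr f g h :
    prop_rel (mafter f (madd g h)) (madd (mafter f g) (mafter f h))
| rel_afterZl a f g : prop_rel (mafter (mscale a f) g) (mscale a (mafter f g))
| rel_afterZr a f g : prop_rel (mafter f (mscale a g)) (mscale a (mafter f g))
| rel_tensDl f g h :
    prop_rel (mtens (madd f g) h) (madd (mtens f h) (mtens g h))
| rel_tensDr f g h :
    prop_rel (mtens f (madd g h)) (madd (mtens f g) (mtens f h))
| rel_tensZl a f g : prop_rel (mtens (mscale a f) g) (mscale a (mtens f g))
| rel_tensZr a f g : prop_rel (mtens f (mscale a g)) (mscale a (mtens f g))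
| rel_afterA f g h : prop_rel (mafter f (mafter g h)) (mafter (mafter f g) h)
| rel_after1l f : prop_rel (mafter (mone (tout f)) f) f
| rel_after1r f : prop_rel (mafter f (mone (tin f))) f
| rel_tensA f g h : prop_rel (mtens f (mtens g h)) (mtens (mtens f g) h)
| rel_tens1l f : prop_rel (mtens (mone 0) f) f
| rel_tens1r f : prop_rel (mtens f (mone 0)) f
| rel_tens1 m n : prop_rel (mtens (mone m) (mone n)) (mone (m + n))
| rel_interchange f g f' g' :
    prop_rel (mafter (mtens f g) (mtens f' g'))
      (mscale ((-1) ^+ (tdeg g * tdeg f')) (mtens (mafter f f') (mafter g g')))
| rel_swap_natural f g :
    prop_rel (mafter (mswap (tout f) (tout g)) (mtens f g))
      (mscale ((-1) ^+ (tdeg f * tdeg g))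
        (mafter (mtens g f) (mswap (tin f) (tin g))))
| rel_swapK m n : prop_rel (mafter (mswap n m) (mswap m n)) (mone (m + n))
| rel_swapD m n p :
    prop_rel (mswap m (n + p))
      (mafter (mtens (mone n) (mswap m p)) (mtens (mswap m n) (mone p)))
| rel_counit_r : prop_rel (mafter (mtens (mone 1) mcou) mcop) (mone 1)
| rel_counit_l : prop_rel (mafter (mtens mcou (mone 1)) mcop) (mone 1)
| rel_cou_join : prop_rel (mafter mcou mjoin) (mzero 2 0 1).

Inductive meq : term -> term -> Prop :=
| meq_rel s t : prop_rel s t -> well_formed s -> well_formed t ->
    same_type s t -> meq s t
| meq_refl t : meq t t
| meq_sym s t : meq s t -> meq t s
| meq_trans s t u : meq s t -> meq t u -> meq s u
| meq_after g g' f f' : meq g g' -> meq f f' -> meq (mafter g f) (mafter g' f')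
| meq_tens f f' g g' : meq f f' -> meq g g' -> meq (mtens f g) (mtens f' g')
| meq_add f f' g g' : meq f f' -> meq g g' -> meq (madd f g) (madd f' g')
| meq_scale a f f' : meq f f' -> meq (mscale a f) (mscale a f').

Section Quotient.
Variables m n d : nat.

Record mrep := MRep { mrep_val : term; _ : has_type m n d mrep_val }.
HB.instance Definition _ := [isSub for mrep_val].
HB.instance Definition _ := [Choice of mrep by <:].

Definition meqb : rel mrep := fun s t => `[< meq (val s) (val t) >].

Lemma meqb_refl : reflexive meqb.
Proof. by move=> s; apply/asboolP; exact: meq_refl. Qed.

Lemma meqb_sym : symmetric meqb.
Proof. by move=> s t; apply/asboolP/asboolP; exact: meq_sym. Qed.

Lemma meqb_trans : transitive meqb.
Proof.
by move=> t s u /asboolP st /asboolP tu; apply/asboolP; exact: meq_trans st tu.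
Qed.

Canonical meqb_equiv := EquivRel meqb meqb_refl meqb_sym meqb_trans.
Canonical meqb_encModRel := defaultEncModRel meqb.

(* The component M(m, n)_d *)
Definition propM := {eq_quot meqb}.
HB.instance Definition _ : EqQuotient mrep meqb propM := EqQuotient.on propM.

End Quotient.

(* The component of degree d of UM(r) = M(1, r) *)
Definition UM (r d : nat) := propM 1 r d.

Definition wdim (w : seq cell) : nat := sumn [seq cdim x | x <- w].

(* The operation denoted by a term on tensor powers of the chains of a product
   of standard simplices. *)
Fixpoint mdenote (t : term) (w : seq cell) : freemod K (seq cell) :=
  match t with
  | mone n => fdelta w
  | mswap m n =>
      (-1) ^+ (wdim (take m w) * wdim (drop m w)) *: fdelta (drop m w ++ take m w)
  | mcop => flin (fun ab => fdelta [:: ab.1; ab.2]) (coprod K (nth [::] w 0))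
  | mcou => ceps K (nth [::] w 0) *: fdelta [::]
  | mjoin => flin (fun z => fdelta [:: z]) (cjoin K (nth [::] w 0) (nth [::] w 1))
  | mafter g f => flin (mdenote g) (mdenote f w)
  | mtens f g =>
      (-1) ^+ (tdeg g * wdim (take (tin f) w)) *:
      tmul (mdenote f (take (tin f) w)) (mdenote g (drop (tin f) w))
  | mzero _ _ _ => 0
  | madd f g => mdenote f w + mdenote g w
  | mscale a f => a *: mdenote f w
  end.

End Prop_M.

(** * UM-coalgebras *)

(* The complex and the structure maps of a UM-coalgebra.  The axioms of an operad
   map are properties of the structure maps considered below and play no part in
   the notion of morphism. *)
Record umcoalg (K : comPzRingType) := UMCoalg {
  umcx :> bcomplex K;
  umop : forall r d, UM K r d -> chain umcx -> tens umcx }.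

Section MultiSimplicialCoalgebra.
Variables (K : comPzRingType) (k : nat) (X : mset k).

Definition top_cell (n : {ffun 'I_k -> nat}) : cell :=
  [seq iota 0 (n j).+1 | j <- enum 'I_k].

Definition cell_mmap (x : cell) : {ffun 'I_k -> seq nat} :=
  [ffun j : 'I_k => nth [::] x j].

(* p(x) = N(xi)^{(x) r} p([0, ..., n_1] (x) ... (x) [0, ..., n_k]), the operation
   p of UM being represented by a term; the result does not depend on the
   representative since the chains of products of standard simplices satisfy
   the relations of M. *)
Definition nchains_op r d (p : UM K r d) :
    chain (nchains K X) -> tens (nchains K X) :=
  flin (fun x =>
    tpow (fun c => char_map K (nval x) (cell_mmap c))
      (mdenote (val (repr p)) [:: top_cell (tag (nval x))])).

Definition nchains_coalg : umcoalg K :=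
  {| umcx := nchains K X; umop := nchains_op |}.

End MultiSimplicialCoalgebra.

Section Morphisms.
Variables (K : comPzRingType) (C D : umcoalg K).

Definition umcoalg_map (f : chain C -> chain D) : Prop :=
  chain_map f /\
  forall r d (p : UM K r d) (c : chain C),
    umop p (f c) = tpow (fun b => f (fdelta b)) (umop p c).

Definition umcoalg_quasi_iso (f : chain C -> chain D) : Prop :=
  umcoalg_map f /\ quasi_iso f.

End Morphisms.

(* k-fold singular chains *)
Definition sing_chains (K : comPzRingType) (R : realType) (k : nat)
    (T : topologicalType) : umcoalg K :=
  nchains_coalg K (sing R k T).

(* Main.v *)
From HB Require Import structures.
From mathcomp Require Import all_boot all_order all_algebra.
From mathcomp Require Import all_classical all_reals all_analysis.
From mathcomp Require Import zify.
Require Import Defs.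
Import numFieldNormedType.Exports.
Import Order.TTheory GRing.Theory Num.Theory.

(** Write f for the comparison map from simplicial to k-fold singular chains, and call
a k-fold multisimplex flat when its dimensions in the directions other than the first
vanish.  As the zero-dimensional simplex is a point, f identifies the simplicial chains
with the span of the flat multisimplices; [restr1] is the inverse on generators.

Quasi-isomorphism.  The point is that the directions other than the first can be
contracted.  Coordinatewise minimum with a number in [0, 1] contracts every simplex
Delta^m to its zeroth vertex, and it commutes with dropping or repeating coordinates.
Feeding the coordinates of the first factor into this contraction gives prism
operators: the p-th prism of x is
   (t, u_2, ..., u_k) |-> x (t without t_(p+1), min (t_(p+1), u_2), ...).
Let P be their alternating sum.  By the simplicial identities ([sum_prism]), the
boundary in the first direction satisfies d_1 P + P d_1 = id - E, where E restricts the
other factors to their zeroth vertices; E x is degenerate unless x is flat, so E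
vanishes on the normalized chains of positive total dimension in the other directions.
Since P does not change this dimension and the remaining part of the boundary lowers
it by one, id - d P - P d lowers it as well ([on_descend]).  On flat chains P is zero.
Iterating, every cycle is homologous to a flat cycle ([flat_cycle]) and every flat
boundary bounds a flat chain ([flat_boundary]), which is the bijectivity of f on
homology ([proj_chain_quasi_iso]).  Besides the identity in the first direction, this
uses that P kills degenerate multisimplices ([prism_degenerate]) and that the square of
the boundary is zero ([bnd_bnd]).

Coalgebra map.  The value of an operation on x is the image of its value on the top
cell of a product of standard simplices, and for the image of a simplex this product
is Delta^n times k - 1 points.  A point has a trivial diagonal, counit 1 and no nonzero
join with itself, so padding a face of Delta^n by points commutes with the diagonal,
the counit and the join, and hence with whatever term represents the operation
([mdenote_pad]).  Both sides of the morphism condition are computed from the same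
representative, which gives [proj_chain_umop]. *)

Set Implicit Arguments.
Unset Strict Implicit.
Unset Printing Implicit Defensive.

Local Open Scope classical_set_scope.
Local Open Scope quotient_scope.
Local Open Scope ring_scope.

(** * Linear maps out of free modules *)

Section FreeModules.
Variables (K : comPzRingType) (B : choiceType).
Implicit Types (c : freemod K B) (S : B -> Prop).

(** Supports express homogeneity, the filtration by dimension and the lengths of words
alike; [homog] is the special case of the degree. *)
Definition supported S c : Prop := forall b, c b != 0 -> S b.

Lemma freemodP c c' : c =1 c' -> c = c'.
Proof. by move=> h; apply: val_inj; apply: functional_extensionality_dep. Qed.

Lemma coef_sum (I : Type) (r : seq I) (P : pred I) (F : I -> freemod K B) b :
  (\sum_(i <- r | P i) F i) b = \sum_(i <- r | P i) F i b.
Proof.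
exact: (big_morph (fun c : freemod K B => c b : K)).
Qed.

Lemma coefZ a c b : (a *: c) b = a * c b.
Proof. by []. Qed.

Lemma coef_delta b b' : (fdelta b : freemod K B) b' = (b' == b)%:R.
Proof. by []. Qed.

Lemma supported_delta S b : S b -> supported S (fdelta b).
Proof.
by move=> Sb b'; rewrite coef_delta; case: (eqVneq b' b) => [->|] //=; rewrite eqxx.
Qed.

Lemma supported_lin S a c c' :
  supported S c -> supported S c' -> supported S (a *: c + c').
Proof.
move=> hc hc' b; rewrite [X in X != 0](_ : _ = a * c b + c' b) //.
have [->|/hc//] := eqVneq (c b) 0; have [->|/hc'//] := eqVneq (c' b) 0.
by rewrite mulr0 addr0 eqxx.
Qed.

Lemma supported0 S : supported S 0.
Proof. by move=> b; rewrite eqxx. Qed.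

Lemma supportedZ S a c : supported S c -> supported S (a *: c).
Proof.
by move=> hc; rewrite -[_ *: _]addr0; apply: supported_lin (supported0 _).
Qed.

Lemma supportedD S c c' :
  supported S c -> supported S c' -> supported S (c + c').
Proof. by move=> hc hc'; rewrite -[c]scale1r; apply: supported_lin. Qed.

Lemma supportedN S c : supported S c -> supported S (- c).
Proof. by rewrite -scaleN1r; exact: supportedZ. Qed.

Lemma supported_sum S (I : Type) (r : seq I) (P : pred I) F :
  (forall i, P i -> supported S (F i)) ->
  supported S (\sum_(i <- r | P i) F i).
Proof.
by move=> h; apply: (big_ind (supported S)) => //;
  [exact: supported0 | move=> *; exact: supportedD].
Qed.

Lemma sub_supported S S' c :
  (forall b, S b -> S' b) -> supported S c -> supported S' c.
Proof. by move=> SS' h b /h /SS'. Qed.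

Lemma flin_fdelta c : flin fdelta c = c.
Proof.
have /asboolP fc := coefP c; apply: freemodP => b.
rewrite (flin_sum _ fc) // fsbig_finite //= coef_sum.
under eq_bigr => b' _ do rewrite coefZ coef_delta.
have [cb|cb] := eqVneq (c b) 0.
  rewrite cb big1_seq // => b' /andP[_].
  case: (eqVneq b b') => [<- _|]; first by rewrite cb mul0r.
  by rewrite mulr0.
rewrite (bigD1_seq b) ?finmap.fset_uniq //=; last by rewrite in_fset_set // inE.
by rewrite eqxx mulr1 big1 ?addr0 // => b' /negPf; rewrite eq_sym => ->; rewrite mulr0.
Qed.

(** A chain is a finite combination of basis elements, so what holds for these and
passes to linear combinations holds for it. *)
Lemma supported_ind S (P : freemod K B -> Prop) :
  P 0 -> (forall a b c, S b -> P c -> P (a *: fdelta b + c)) ->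
  forall c, supported S c -> P c.
Proof.
move=> P0 PS c hc; have /asboolP fc := coefP c.
rewrite -[c]flin_fdelta (flin_sum _ fc) // fsbig_finite //=.
rewrite big_seq; elim/big_rec: _ => // b x.
by rewrite in_fset_set // inE => /hc Sb; exact: PS.
Qed.

Lemma eq_flin_supported S (V : lmodType K) (phi psi : B -> V) c :
  (forall b, S b -> phi b = psi b) -> supported S c ->
  flin phi c = flin psi c.
Proof.
move=> e; move: c; refine (supported_ind _ _) => [|a b c Sb IH].
  by rewrite !linear0.
by rewrite !linearP /= !flin_delta e // IH.
Qed.

Lemma eq_flin (V : lmodType K) (phi psi : B -> V) c :
  phi =1 psi -> flin phi c = flin psi c.
Proof. by move=> e; apply: (@eq_flin_supported (fun=> True)). Qed.

Lemma linear_flin (V : lmodType K) (f : freemod K B -> V) c :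
  linear f -> f c = flin (fun b => f (fdelta b)) c.
Proof.
move=> lf; have f0 : f 0 = 0.
  by have := lf (-1) 0 0; rewrite scaler0 addr0 scaleN1r addNr.
have: supported (fun=> True) c by []; move: c; refine (supported_ind _ _) => // [|a b c _ IH].
  by rewrite linear0.
by rewrite lf linearP /= flin_delta IH.
Qed.

Lemma eq_linear (V : lmodType K) (f g : freemod K B -> V) :
  linear f -> linear g -> (forall b, f (fdelta b) = g (fdelta b)) -> f =1 g.
Proof.
by move=> lf lg e c; rewrite (linear_flin _ lf) (linear_flin _ lg); exact: eq_flin.
Qed.

End FreeModules.

Lemma comp_linear (K : comPzRingType) (U V W : lmodType K) (f : V -> W)
    (g : U -> V) :
  linear f -> linear g -> linear (fun u => f (g u)).
Proof. by move=> lf lg a u v; rewrite lg lf. Qed.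

Lemma flin_linear (K : comPzRingType) (B : choiceType) (V : lmodType K)
    (phi : B -> V) : linear (flin phi).
Proof. exact: flin_is_linear. Qed.

Section FreeModuleMaps.
Variables (K : comPzRingType) (B B' : choiceType).

Lemma supported_flin (S : B -> Prop) (S' : B' -> Prop)
    (phi : B -> freemod K B') c :
  (forall b, S b -> supported S' (phi b)) -> supported S c ->
  supported S' (flin phi c).
Proof.
move=> h; move: c; refine (supported_ind _ _) => [|a b c Sb IH].
  by rewrite linear0; exact: supported0.
by rewrite linearP /= flin_delta; apply: supported_lin => //; exact: h.
Qed.

Lemma flin_comp (V : lmodType K) (psi : B' -> V) (phi : B -> freemod K B') c :
  flin psi (flin phi c) = flin (fun b => flin psi (phi b)) c.
Proof.
have: supported (fun=> True) c by []; move: c; refine (supported_ind _ _) => // [|a b c _ IH].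
  by rewrite !linear0.
by rewrite !linearP /= !flin_delta IH.
Qed.

Lemma flin_map (V : lmodType K) (psi : B' -> V) (h : B -> B') c :
  flin psi (flin (fun b => fdelta (h b)) c) = flin (fun b => psi (h b)) c.
Proof. by rewrite flin_comp; apply: eq_flin => b; rewrite flin_delta. Qed.

End FreeModuleMaps.

(** * Singular multisimplices in coordinates *)

Section SimplexCoordinates.
Variable R : realType.

Lemma tcoord_over n (t : 'rV[R]_n) c : (n < c)%N -> tcoord t c = 0.
Proof.
case: c => //= c nc; case: insubP => [u _ ec|//].
by move: nc; rewrite -ec ltnS leqNgt ltn_ord.
Qed.

(** All coordinates beyond the dimension are 0, so an index can be truncated. *)
Lemma tcoord_minn n (t : 'rV[R]_n) c : tcoord t (minn c n.+1) = tcoord t c.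
Proof. by case: (leqP c n.+1) => // cn; rewrite !tcoord_over // ltnW. Qed.

Lemma tcoord_inj n (t u : 'rV[R]_n) : tcoord t =1 tcoord u -> t = u.
Proof.
move=> e; apply/rowP => i; have := e i.+1; rewrite /= insubT //= => ?.
by rewrite (_ : Sub _ _ = i) //; apply: val_inj.
Qed.

Lemma tcoord01 n (t : simplex R n) c : 0 <= tcoord (val t) c <= 1.
Proof.
have /set_mem[t01 _] := valP t.
case: c => [|c] /=; first by rewrite ler01 lexx.
by case: insubP => [u _ _|_] /=; rewrite ?lexx ?ler01.
Qed.

Lemma tcoord_le n (t : simplex R n) c d : (c <= d)%N ->
  tcoord (val t) d <= tcoord (val t) c.
Proof.
have /set_mem[_ tdec] := valP t.
case: c d => [|c] [|d] // cd; first by have /andP[] := tcoord01 t d.+1.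
rewrite /=; case: insubP => [d' _ ed|_] /=; last first.
  by have /andP[] := tcoord01 t c.+1.
case: insubP => [c' _ ec|] /=; first by apply: tdec; rewrite ed ec.
by rewrite -leqNgt => nc; move: (ltn_ord d'); rewrite ed ltnNge (leq_trans nc).
Qed.

Lemma count_lt_iota i len c :
  count (fun v => v < c)%N (iota i len) = minn (c - i) len.
Proof.
elim: len i => [|len IH] i /=; first by rewrite minn0.
by rewrite IH; case: (ltnP i c) => ic /=; lia.
Qed.

(** In coordinates, the l-th coface repeats the l-th coordinate and the i-th
codegeneracy drops the (i+1)-st; this also accounts for the constant coordinates 1 and
0 at both ends, so that the extreme faces need no separate treatment. *)
Lemma tcoord_face n (t : 'rV[R]_n) l c : (l <= n.+1)%N ->
  tcoord t (count (fun v => v < c)%N (rem l (iota 0 n.+2))) =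
  tcoord t (unbump l c).
Proof.
move=> ln; have li : l \in iota 0 n.+2 by rewrite mem_iota.
have /permP/(_ (fun v => v < c)%N) := perm_to_rem li.
rewrite count_lt_iota subn0 /=; set N := count _ _ => eN.
have -> : N = (minn c n.+2 - (l < c))%N by rewrite eN addKn.
case: (leqP c n.+2) => // cn; rewrite !tcoord_over //.
  by rewrite /unbump -(ltn_add2r (l < c)) subnK; case: (l < c)%N; lia.
by rewrite (leq_ltn_trans ln) //; lia.
Qed.

Lemma tcoord_degen n (t : 'rV[R]_n.+1) i c : (i <= n)%N ->
  tcoord t (count (fun v => v < c)%N (iota 0 i.+1 ++ iota i (n.+1 - i))) =
  tcoord t (bump i.+1 c).
Proof.
move=> le_in; rewrite count_cat !count_lt_iota subn0 /bump.
case: (leqP c n.+1) => cn; first by congr tcoord; lia.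
by rewrite !tcoord_over //; lia.
Qed.

End SimplexCoordinates.

Section Points.
Variables (R : realType) (k : nat).
Local Notation idx := {ffun 'I_k -> nat}.
Implicit Types (n m : idx) (j : 'I_k).

Definition crd n (t : prod_simplex R n) j c : R := tcoord (val (t j)) c.

Lemma crd_inj n (t u : prod_simplex R n) : crd t =2 crd u -> t = u.
Proof.
move=> e; apply: functional_extensionality_dep => j; apply: val_inj.
by apply: tcoord_inj => c; exact: e.
Qed.

Lemma crd0 n (t : prod_simplex R n) j : crd t j 0 = 1.
Proof. by []. Qed.

Lemma crd_over n (t : prod_simplex R n) j c : (n j < c)%N -> crd t j c = 0.
Proof. exact: tcoord_over. Qed.

Lemma crd_prod_simplex_map m n s (t : prod_simplex R m) j c : mhom m n s ->
  crd (prod_simplex_map n s t) j c = crd t j (count (fun v => v < c)%N (s j)).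
Proof. by move=> /forallP/(_ j)/and3P[/eqP ? ? ?]; exact: tcoord_push. Qed.

Lemma crd_point n (t : prod_simplex R n) j c :
  n j = 0%N -> crd t j c = (c == 0%N)%:R.
Proof. by case: c => [|c] nj; [rewrite crd0 | rewrite crd_over ?nj]. Qed.

Definition idx_down n j : idx := [ffun j' => n j' - (j' == j)]%N.
Definition idx_up n j : idx := [ffun j' => n j' + (j' == j)]%N.

Lemma mhom_face n j l : (0 < n j)%N -> (l <= n j)%N ->
  mhom (idx_down n j) n (mface n j l).
Proof.
move=> nj ln; apply/forallP => j'; rewrite !ffunE.
have iota_ok N : [&& size (iota 0 N.+1) == N.+1, sorted leq (iota 0 N.+1) &
    all (fun i => i <= N)%N (iota 0 N.+1)].
  rewrite size_iota eqxx iota_sorted; apply/allP => i.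
  by rewrite mem_iota.
case: (eqVneq j' j) => [->|_]; last by rewrite subn0; exact: iota_ok.
have lN : l \in iota 0 (n j).+1 by rewrite mem_iota.
have /and3P[_ so al] := iota_ok (n j).
rewrite size_rem // size_iota subn1 prednK // eqxx.
rewrite (subseq_sorted leq_trans (rem_subseq _ _) so) !andTb.
by apply/allP => i /mem_rem /(allP al).
Qed.

Lemma mhom_degen n j i : (i <= n j)%N -> mhom (idx_up n j) n (mdegen n j i).
Proof.
move=> ln; apply/forallP => j'; rewrite !ffunE.
case: (eqVneq j' j) => [->|_]; last first.
  rewrite addn0 size_iota eqxx iota_sorted.
  by apply/allP => v; rewrite mem_iota.
rewrite size_cat !size_iota; apply/and3P; split; first by apply/eqP; lia.
  rewrite (sorted_pairwise leq_trans) pairwise_cat.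
  rewrite -!(sorted_pairwise leq_trans) !iota_sorted !andbT.
  by apply/allrelP => v w; rewrite !mem_iota; lia.
by apply/allP => v; rewrite mem_cat !mem_iota; lia.
Qed.

Lemma crd_face m n j l (t : prod_simplex R m) j' c :
  mhom m n (mface n j l) -> (l <= n j)%N ->
  crd (prod_simplex_map n (mface n j l) t) j' c =
  crd t j' (if j' == j then unbump l c else c).
Proof.
move=> h ln; rewrite crd_prod_simplex_map // /crd ffunE.
have /forallP/(_ j')/and3P[/eqP + _ _] := h; rewrite ffunE.
case: (eqVneq j' j) => [->|_].
  rewrite size_rem ?mem_iota // size_iota /= => mj.
  by move: (val (t j)); rewrite -?mj mj => ?; rewrite tcoord_face // -mj.
rewrite size_iota => -[mj]; rewrite count_lt_iota subn0.
by move: (val (t j')); rewrite -mj => ?; exact: tcoord_minn.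
Qed.

Lemma crd_degen m n j i (t : prod_simplex R m) j' c :
  mhom m n (mdegen n j i) -> (i <= n j)%N ->
  crd (prod_simplex_map n (mdegen n j i) t) j' c =
  crd t j' (if j' == j then bump i.+1 c else c).
Proof.
move=> h ln; rewrite crd_prod_simplex_map // /crd ffunE.
have /forallP/(_ j')/and3P[/eqP + _ _] := h; rewrite ffunE.
case: (eqVneq j' j) => [->|_].
  rewrite size_cat !size_iota addSn subnKC; last exact: leqW.
  move=> /eqP; rewrite eqSS => /eqP mj.
  by move: (val (t j)); rewrite -mj => ?; rewrite tcoord_degen.
rewrite size_iota => -[mj]; rewrite count_lt_iota subn0.
by move: (val (t j')); rewrite -mj => ?; exact: tcoord_minn.
Qed.

End Points.

Section SingularMultisimplices.
Variables (R : realType) (T : topologicalType).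

Definition ev k (x : multisimplex (sing R k T)) (t : prod_simplex R (tag x)) : T :=
  (tagged x : continuousType _ _) t.
Arguments ev {k} x t.

(** The coordinates of points make sense across families of dimensions that are only
provably equal, so that no transport between the sets of multisimplices is needed. *)
Lemma sing_eq k (x y : multisimplex (sing R k T)) :
  tag x =1 tag y ->
  (forall t u, crd t =2 crd u -> ev x t = ev y u) -> x = y.
Proof.
case: x y => [m x] [n y] /= /ffunP mn; subst n => e.
congr existT; apply/continuousEP => t.
exact: (e t t).
Qed.

Lemma ev_congr k (x : multisimplex (sing R k T)) t u :
  crd t =2 crd u -> ev x t = ev x u.
Proof. by move=> /crd_inj ->. Qed.

Definition precomp k k' (x : multisimplex (sing R k T)) (m : {ffun 'I_k' -> nat})
    (g : prod_simplex R m -> prod_simplex R (tag x)) (gc : continuous g) :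
    multisimplex (sing R k' T) :=
  existT (msimp (sing R k' T)) m
    ((tagged x : continuousType _ _) \o mkcts gc : continuousType _ _).

Definition face k (x : multisimplex (sing R k T)) j l :
    multisimplex (sing R k T) :=
  precomp (@prod_simplex_map_continuous R k (tag x) (idx_down (tag x) j)
    (mface (tag x) j l)).

Definition ignores k (x : multisimplex (sing R k T)) j c : Prop :=
  forall t u, (forall j' c', (j', c') != (j, c) -> crd t j' c' = crd u j' c') ->
    ev x t = ev x u.

(** The i-th degeneracy precomposes with a map that drops the coordinate i + 1.
Conversely, the composite of this map with a coface only alters that coordinate, so a
multisimplex ignoring it is the degeneracy of its own face. *)
Lemma sing_degenerateP k (x : multisimplex (sing R k T)) :
  degenerate x <-> exists j i, (i < tag x j)%N /\ ignores x j i.+1.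
Proof.
split=> [[n [j [i [ni [h [y xy]]]]]]|[j [i [ij hx]]]].
  exists j, i; split=> [|t u tu].
    have /forallP/(_ j)/and3P[/eqP + _ _] := h; rewrite ffunE eqxx.
    rewrite size_cat !size_iota addSn subnKC => [[<-] //|]; exact: leqW.
  have /(congr1 (y : continuousType (prod_simplex R n) T)) :
      prod_simplex_map n (mdegen n j i) t = prod_simplex_map n (mdegen n j i) u.
    apply: crd_inj => j' c; rewrite !crd_degen //; apply: tu.
    rewrite xpair_eqE; case: eqP => //= _.
    by rewrite eq_sym neq_bump.
  by rewrite /ev xy.
case: x ij hx => n x /= ij hx.
have nj : (0 < n j)%N by apply: leq_ltn_trans ij.
have hf := mhom_face nj (ltnW ij).
exists (idx_down n j), j, i; split; first by rewrite ffunE eqxx /=; lia.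
have h : mhom n (idx_down n j) (mdegen (idx_down n j) j i).
  rewrite -[X in mhom X](_ : idx_up (idx_down n j) j = n).
    by apply: mhom_degen; rewrite ffunE eqxx /=; lia.
  by apply/ffunP => j'; rewrite !ffunE; case: eqVneq => [->|] /=; lia.
exists h, (tagged (@face k (existT _ n x) j i)).
apply/continuousEP => t.
apply: (hx t (prod_simplex_map n (mface n j i)
  (prod_simplex_map (idx_down n j) (mdegen (idx_down n j) j i) t))) => j' c.
rewrite xpair_eqE crd_face 1?ltnW // crd_degen //; last first.
  by rewrite ffunE eqxx /=; lia.
case: (eqVneq j' j) => //= _ ci; congr crd.
by move: ci; rewrite /bump /unbump; lia.
Qed.

End SingularMultisimplices.

Arguments ev {R T k} x t.

(** * Generators of normalized chains *)

(** The case analysis in [char_map] is on a proof of a Boolean that occurs in the type of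
its branch; generalizing over the proposition makes it possible. *)
Lemma reflect_matchT (P : Prop) b (r : reflect P b) (V : Type) (F : P -> V) v h :
  (forall h', F h' = F h) -> (if r is ReflectT h' then F h' else v) = F h.
Proof. by case: r. Qed.

Lemma reflect_matchF (P : Prop) b (r : reflect P b) (V : Type) (F : P -> V) v :
  ~ P -> (if r is ReflectT h' then F h' else v) = v.
Proof. by case: r. Qed.

Section CharacteristicMaps.

Variables (K : comPzRingType) (k : nat) (X : mset k).
Local Notation idx := {ffun 'I_k -> nat}.

Lemma char_mapE (x : multisimplex X) (m : idx) t (h : mhom m (tag x) t) :
  char_map K x t = ngen K (Tagged (msimp X) (mpull h (tagged x))).
Proof.
have em : m = [ffun j => (size (t j)).-1].
  by apply/ffunP => j; rewrite ffunE; have /forallP/(_ j)/and3P[/eqP -> _ _] := h.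
rewrite /char_map; subst m; apply: reflect_matchT => h'.
by rewrite (bool_irrelevance h' h).
Qed.

Lemma char_map0 (x : multisimplex X) t :
  (forall m, ~~ mhom m (tag x) t) -> char_map K x t = 0.
Proof.
by move=> nh; apply: reflect_matchF; apply/negP.
Qed.

Lemma ngen_degenerate (x : multisimplex X) : degenerate x -> ngen K x = 0.
Proof.
by move=> dx; rewrite /ngen insubF //; apply/negbF/asboolP.
Qed.

Lemma ngen_nval (b : nondeg X) : ngen K (nval b) = fdelta b.
Proof. by rewrite /ngen (valK b). Qed.

Lemma ngenP (x : multisimplex X) :
  {b : nondeg X | nval b = x} + {degenerate x}.
Proof.
have [dx|/asboolPn ndx] := pselect (degenerate x); first by right.
by left; exists (NonDeg ndx).
Qed.

(** A function on all multisimplices induces a map on normalized chains as soon as it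
kills the degenerate ones. *)
Lemma flin_ngen (V : lmodType K) (F : multisimplex X -> V) x :
  (forall y, degenerate y -> F y = 0) ->
  flin (fun b : nondeg X => F (nval b)) (ngen K x) = F x.
Proof.
move=> F0; case: (ngenP x) => [[b <-]|dx]; first by rewrite ngen_nval flin_delta.
by rewrite (ngen_degenerate dx) linear0 F0.
Qed.

Lemma supported_ngen (S : multisimplex X -> Prop) x :
  S x -> supported (fun b : nondeg X => S (nval b)) (ngen K x).
Proof.
move=> Sx; case: (ngenP x) => [[b bx]|/ngen_degenerate ->].
  by rewrite -bx ngen_nval; apply: supported_delta; rewrite bx.
exact: supported0.
Qed.

End CharacteristicMaps.

Section SingularFaces.
Variables (K : comPzRingType) (R : realType) (T : topologicalType) (k : nat).
Implicit Types (x : multisimplex (sing R k T)) (j : 'I_k).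

Lemma char_map_face x j l : (0 < tag x j)%N -> (l <= tag x j)%N ->
  char_map K x (mface (tag x) j l) = ngen K (face x j l).
Proof. by move=> xj lx; rewrite (char_mapE _ (mhom_face xj lx)). Qed.

Lemma char_map_face0 x j l : tag x j = 0%N -> (l <= tag x j)%N ->
  char_map K x (mface (tag x) j l) = 0.
Proof.
move=> xj; rewrite xj leqn0 => /eqP ->; apply: char_map0 => m.
by apply/forallPn; exists j; rewrite ffunE eqxx xj.
Qed.

Definition face_map x j l (t : prod_simplex R (tag (face x j l))) :
    prod_simplex R (tag x) :=
  prod_simplex_map (tag x) (mface (tag x) j l) t.

Lemma ev_face x j l t : ev (face x j l) t = ev x (face_map t).
Proof. by []. Qed.

Lemma crd_face_map x j l (t : prod_simplex R (tag (face x j l))) j' c :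
  (0 < tag x j)%N -> (l <= tag x j)%N ->
  crd (face_map t) j' c = crd t j' (if j' == j then unbump l c else c).
Proof. by move=> xj lx; apply: crd_face => //; exact: mhom_face. Qed.

Lemma tag_face x j l j' : tag (face x j l) j' = (tag x j' - (j' == j))%N.
Proof. by rewrite ffunE. Qed.

Lemma tag_face1 x j l : tag (face x j l) j = (tag x j).-1.
Proof. by rewrite tag_face eqxx subn1. Qed.

End SingularFaces.

(** * The boundary of singular multisimplices *)

Section AlternatingSums.
Variables (K : comPzRingType) (V : lmodType K).
Implicit Types (A B : nat -> nat -> V) (r : nat -> V).
Local Notation sgn := (fun n => (-1) ^+ n : K).

Lemma sum_antisym k (D : 'I_k -> 'I_k -> V) :
  (forall i j, i != j -> D i j = - D j i) -> (forall i, D i i = 0) ->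
  \sum_i \sum_j D i j = 0.
Proof.
move=> anti diag.
pose L (i j : 'I_k) : V := if (i < j)%N then D i j else 0.
have -> : \sum_i \sum_j D i j = \sum_i \sum_j L i j - \sum_i \sum_j L j i.
  rewrite -sumrB; apply: eq_bigr => i _; rewrite -sumrB; apply: eq_bigr => j _.
  rewrite /L; case: ltngtP => [_|ij|/val_inj <-]; rewrite ?subr0 ?diag //.
  by rewrite sub0r anti // neq_ltn ij orbT.
by rewrite [X in _ - X]exchange_big subrr.
Qed.

(** The terms below the diagonal cancel those on and above it. *)
Lemma sum_simplicial N A :
  (forall l l', (l' < l)%N -> (l <= N)%N -> A l l' = A l' l.-1) ->
  \sum_(0 <= l < N.+1) \sum_(0 <= l' < N) sgn (l + l')%N *: A l l' = 0.
Proof.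
move=> hA.
pose L (l l' : nat) : V := if (l' < l)%N then sgn (l + l')%N *: A l l' else 0.
pose U (l l' : nat) : V := if (l <= l')%N then sgn (l + l')%N *: A l l' else 0.
have -> : \sum_(0 <= l < N.+1) \sum_(0 <= l' < N) sgn (l + l')%N *: A l l' =
    \sum_(0 <= l < N.+1) \sum_(0 <= l' < N) L l l' +
    \sum_(0 <= l < N.+1) \sum_(0 <= l' < N) U l l'.
  rewrite -big_split; apply: eq_bigr => l _; rewrite -big_split.
  by apply: eq_bigr => l' _; rewrite /L /U /=; case: ltnP; rewrite ?addr0 ?add0r.
rewrite big_nat_recl // [X in X + _ + _]big1 ?add0r //.
rewrite [X in _ + X]big_nat_recr //= [X in _ + (_ + X)]big1_seq ?addr0; last first.
  by move=> l'; rewrite mem_index_iota /U; case: leqP => //; lia.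
rewrite [X in _ + X]exchange_big -big_split big_nat big1 //= => l lN.
rewrite -big_split big1 //= => l' _; rewrite /L /U ltnS.
case: leqP => // l'l; last by rewrite addr0.
by rewrite hA //= addSn exprS mulN1r scaleNr addnC addNr.
Qed.

(** Here A j l is the l-th face of the j-th prism, and B l j the j-th prism of the l-th
face.  The faces of a prism which are not prisms of faces are those separating two
consecutive prisms, and only the two outermost ones survive. *)
Lemma sum_prism n A B r :
  (forall j l, (l < j)%N -> (j <= n)%N -> A j l = B l j.-1) ->
  (forall j l, (j.+1 < l)%N -> (l <= n.+1)%N -> A j l = B l.-1 j) ->
  (forall j, (j <= n)%N -> A j j = r j) ->
  (forall j, (j <= n)%N -> A j j.+1 = r j.+1) ->
  \sum_(0 <= j < n.+1) \sum_(0 <= l < n.+2) sgn (j + l)%N *: A j l +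
  \sum_(0 <= l < n.+1) \sum_(0 <= j < n) sgn (j + l)%N *: B l j =
  r 0 - r n.+1.
Proof.
move=> hlt hgt heq hS.
(* the terms with l < j, l = j, l = j + 1 and l > j + 1 *)
pose L (j l : nat) : V := if (l < j)%N then sgn (j + l)%N *: A j l else 0.
pose M (j l : nat) : V := if l == j then r j else 0.
pose M' (j l : nat) : V := if l == j.+1 then - r j.+1 else 0.
pose U (j l : nat) : V := if (j.+1 < l)%N then sgn (j + l)%N *: A j l else 0.
have sgn2 j : sgn (j + j)%N = 1 by rewrite addnn -mul2n exprM sqrrN expr1n expr1n.
transitivity (\sum_(0 <= j < n.+1) \sum_(0 <= l < n.+2) L j l +
  \sum_(0 <= j < n.+1) \sum_(0 <= l < n.+2) U j l +
  \sum_(0 <= l < n.+1) \sum_(0 <= j < n) sgn (j + l)%N *: B l j +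
  (\sum_(0 <= j < n.+1) \sum_(0 <= l < n.+2) M j l +
  \sum_(0 <= j < n.+1) \sum_(0 <= l < n.+2) M' j l)).
  rewrite [in RHS]addrAC; congr (_ + _).
  rewrite -!big_split; apply: eq_big_nat => j /andP[_ jn].
  rewrite -!big_split; apply: eq_big_nat => l /andP[_ ln] /=.
  rewrite /L /U /M /M'; case: (ltngtP l j) => [lj|jl|->].
  - by rewrite ltnNge ltnW ?ltn_eqF ?leqW //= ?addr0.
  - case: (ltngtP l j.+1) => [|_|->]; first by rewrite ltnS leqNgt jl.
      by rewrite add0r !addr0.
    by rewrite hS // addnS exprS mulN1r sgn2 scaleN1r !add0r.
  - by rewrite ltnNge leqW // ltn_eqF // heq // sgn2 scale1r !(add0r, addr0).
rewrite -[RHS]add0r; congr (_ + _).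
  rewrite big_nat_recl // [X in X + _ + _ + _]big1 ?add0r; last by move=> l _.
  rewrite [X in _ + X + _]big_nat_recr //= [X in _ + (_ + X) + _]big1_seq; last first.
    by move=> l; rewrite mem_index_iota /U; case: ltnP => //; lia.
  rewrite addr0 [X in _ + _ + X]exchange_big -!big_split big_nat big1 //= => j jn.
  have L0 : L j.+1 n.+1 = 0 by rewrite /L ltnS ltnNge ltnW.
  have U0 : U j 0%N = 0 by [].
  rewrite big_nat_recr //= L0 addr0.
  rewrite [X in _ + X + _]big_nat_recl //= U0 add0r.
  rewrite -!big_split big_nat big1 //= => l ln; rewrite /L /U !ltnS.
  case: leqP => lj; first by rewrite hlt //= addSn exprS mulN1r scaleNr addr0 addNr.
  by rewrite hgt //= addnS exprS mulN1r scaleNr add0r addNr.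
rewrite -big_split /=.
rewrite (eq_big_nat _ _ (F2 := fun j => r j - r j.+1)); last first.
  move=> j /andP[_ jn]; rewrite /M /M' -!big_mkcond /=.
  congr (_ + _); rewrite big_mkcond.
    rewrite (bigD1_seq j) ?iota_uniq ?mem_index_iota //=; last lia.
    by rewrite eqxx big1 ?addr0 // => l /negPf ->.
  rewrite (bigD1_seq j.+1) ?iota_uniq ?mem_index_iota //=.
  by rewrite eqxx big1 ?addr0 // => l /negPf ->.
rewrite -[RHS]opprB -(@telescope_sumr _ 0 n.+1 r) // -sumrN.
by apply: eq_bigr => j _; rewrite opprB.
Qed.

End AlternatingSums.

Section BoundaryLinear.
Variables (K : comPzRingType) (C : bcomplex K).
Implicit Types u v : chain C.

Lemma bnd0 : bnd (0 : chain C) = 0. Proof. exact: linear0. Qed.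
Lemma bndB u v : bnd (u - v) = bnd u - bnd v. Proof. exact: linearB. Qed.
Lemma bndD u v : bnd (u + v) = bnd u + bnd v. Proof. exact: linearD. Qed.

End BoundaryLinear.

Section Boundary.
Variables (K : comPzRingType) (R : realType) (T : topologicalType) (k : nat).
Local Notation idx := {ffun 'I_k -> nat}.
Implicit Types (x : multisimplex (sing R k T)) (j : 'I_k).
Local Notation sgn := (fun n => (-1) ^+ n : K).

(** A vertex has no faces, although a sum over l <= n has a term for n = 0. *)
Definition nfaces n : nat := if (0 < n)%N then n.+1 else 0.

Lemma nfacesP n l : (l < nfaces n)%N = (0 < n)%N && (l <= n)%N.
Proof. by rewrite /nfaces; case: (ltnP 0 n). Qed.

Definition offset (n : idx) j : nat := \sum_(i < k | (i < j)%N) n i.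

Definition dir_bnd x j : freemod K (nondeg (sing R k T)) :=
  \sum_(0 <= l < nfaces (tag x j)) sgn (offset (tag x) j + l)%N *: ngen K (face x j l).

Lemma bdiffE (b : nondeg (sing R k T)) :
  ndiff K b = \sum_j dir_bnd (nval b) j.
Proof.
apply: eq_bigr => j _; rewrite -(big_mkord xpredT (fun l =>
  (-1) ^+ (_ + l) *: char_map K (nval b) (mface (tag (nval b)) j l))).
rewrite /dir_bnd /nfaces; case: ltnP => xj.
  by apply: eq_big_nat => l /andP[_ lx]; rewrite char_map_face.
rewrite [RHS]big_geq // big_nat big1 // => l /andP[_ lx].
by rewrite char_map_face0 ?scaler0 //; apply/eqP; rewrite -leqn0.
Qed.

Lemma offset_down (n : idx) j j' : (0 < n j)%N ->
  (offset (idx_down n j) j' + (j < j'))%N = offset n j'.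
Proof.
move=> nj; rewrite /offset; case: ltnP => jj'.
  rewrite [in LHS](bigD1 j) // [in RHS](bigD1 j) //= ffunE eqxx /=.
  rewrite (eq_bigr n) => [|i /andP[_ /negPf ij]]; last by rewrite ffunE ij subn0.
  by rewrite addnAC subnK.
rewrite addn0; apply: eq_bigr => i ij'; rewrite ffunE.
by rewrite (_ : i == j = false) ?subn0 //; apply/eqP => ij; move: jj'; rewrite -ij leqNgt ij'.
Qed.

Lemma face_comm x j j' l l' : j != j' ->
  (l < nfaces (tag x j))%N -> (l' < nfaces (tag x j'))%N ->
  face (face x j l) j' l' = face (face x j' l') j l.
Proof.
rewrite !nfacesP => jj' /andP[xj lx] /andP[xj' lx'].
have tag1 : tag (face x j l) j' = tag x j'.
  by rewrite ffunE eq_sym (negPf jj') subn0.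
have tag2 : tag (face x j' l') j = tag x j by rewrite ffunE (negPf jj') subn0.
apply: sing_eq => [i|t u tu]; first by rewrite !ffunE subnAC.
rewrite !ev_face; apply: ev_congr => i c; rewrite !crd_face_map ?tag1 ?tag2 //.
rewrite tu; congr crd.
by case: eqVneq => // ->; rewrite eq_sym (negPf jj').
Qed.

Lemma face_face x j l l' : (l' < l)%N -> (l <= tag x j)%N -> (1 < tag x j)%N ->
  face (face x j l) j l' = face (face x j l') j l.-1.
Proof.
move=> l'l lx xj; have xj0 := ltnW xj.
have tagE d : tag (face x j d) j = (tag x j).-1 by rewrite ffunE eqxx subn1.
apply: sing_eq => [i|t u tu]; first by rewrite !ffunE.
rewrite !ev_face; apply: ev_congr => i c; rewrite !crd_face_map ?tagE //; [|lia..].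
rewrite tu; congr crd; case: eqVneq => // _.
by rewrite /unbump; lia.
Qed.

Lemma ignores_face x j l j0 c0 j1 c1 : (0 < tag x j)%N -> (l <= tag x j)%N ->
  ignores x j0 c0 ->
  (forall j' c, (j', if j' == j then unbump l c else c) = (j1, c1) ->
    (j', c) = (j0, c0)) ->
  ignores (face x j l) j1 c1.
Proof.
move=> xj lx hx h t u tu; apply: hx => j' c; apply: contraNeq => neq.
rewrite !crd_face_map // in neq; apply/eqP/h/eqP.
by apply: contra_neqT neq => /tu.
Qed.

(** The faces of a degeneracy are again degenerate, except for the two which undo it;
these are equal, and their signs are opposite. *)
Lemma dir_bnd_degenerate x j : degenerate x -> dir_bnd x j = 0.
Proof.
move=> /sing_degenerateP[j0 [i [ix hx]]].
have face0 l j1 c1 : (l < nfaces (tag x j))%N -> (c1 < tag (face x j l) j1)%N ->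
    (forall j' c, (j', if j' == j then unbump l c else c) = (j1, c1.+1) ->
    (j', c) = (j0, i.+1)) -> ngen K (face x j l) = 0.
  rewrite nfacesP => /andP[xj lx] c1x h; apply: ngen_degenerate.
  apply/sing_degenerateP; exists j1, c1; split => //.
  exact: (ignores_face xj lx hx h).
rewrite /dir_bnd; have [jj0|jj0] := eqVneq j j0; last first.
  rewrite big_nat big1 // => l /andP[_ lx].
  rewrite (face0 l j0 i) ?scaler0 // => [|j' c].
    by rewrite ffunE eq_sym (negPf jj0) subn0.
  by case: eqVneq => // ->  [/eqP]; rewrite (negPf jj0).
subst j0; have xj : (0 < tag x j)%N by apply: leq_ltn_trans ix.
have other l : (l < nfaces (tag x j))%N -> l != i -> l != i.+1 ->
    ngen K (face x j l) = 0.
  rewrite nfacesP => /andP[_ lx] li li1.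
  have tagE : tag (face x j l) j = (tag x j).-1 by rewrite ffunE eqxx subn1.
  (* the coface shifts the ignored coordinate down by one if l < i, and fixes it if
     l > i + 1 *)
  have [lti|gti] : (l < i)%N \/ (i.+1 < l)%N by lia.
    apply: (face0 l j i.-1); rewrite ?nfacesP ?xj ?tagE //; first lia.
    by move=> j' c; case: eqVneq => [-> []|/eqP ? [//]]; rewrite /unbump => e;
      congr pair; lia.
  apply: (face0 l j i); rewrite ?nfacesP ?xj ?tagE //; first lia.
  by move=> j' c; case: eqVneq => [-> []|/eqP ? [//]]; rewrite /unbump => e;
    congr pair; lia.
have same : face x j i = face x j i.+1.
  apply: sing_eq => // t u tu; rewrite !ev_face; apply: hx => j' c.
  rewrite xpair_eqE !crd_face_map //; last exact: ltnW.
  case: eqVneq => //= _ ci; rewrite tu; congr crd.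
  by move: ci; rewrite /unbump; lia.
rewrite (bigD1_seq i) ?iota_uniq ?mem_index_iota ?nfacesP ?xj //=; last exact: ltnW.
rewrite -big_filter (bigD1_seq i.+1) ?filter_uniq ?iota_uniq //=; last first.
  by rewrite mem_filter mem_index_iota nfacesP xj ix neq_ltn ltnSn orbT.
rewrite same addnS exprS mulN1r scaleNr addrA subrr add0r.
rewrite big_seq_cond big1 // => l; rewrite mem_filter mem_index_iota.
by move=> /andP[/andP[li /andP[_ lx]] li1]; rewrite other ?scaler0.
Qed.

Lemma bnd_ngen x :
  bnd (ngen K x : chain (nchains K (sing R k T))) = \sum_j dir_bnd x j.
Proof.
rewrite /bnd (eq_flin _ bdiffE).
rewrite (flin_ngen (F := fun x => \sum_j dir_bnd x j)) // => y dy.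
by rewrite big1 // => j _; exact: dir_bnd_degenerate.
Qed.

(** Faces in different directions commute, but taking one first lowers by one the offset
in the sign of the other, so the components of the boundary anticommute. *)
Lemma bnd_bnd (c : chain (nchains K (sing R k T))) : bnd (bnd c) = 0.
Proof.
move: c; apply: eq_linear => [| |b].
- by apply: comp_linear; exact: flin_linear.
- by move=> a u v; rewrite scaler0 addr0.
rewrite -ngen_nval; move: (nval b) => {b} x; rewrite bnd_ngen.
pose D j j' : freemod K (nondeg (sing R k T)) :=
  \sum_(0 <= l < nfaces (tag x j)) sgn (offset (tag x) j + l)%N *:
    dir_bnd (face x j l) j'.
transitivity (\sum_j \sum_j' D j j').
  rewrite /bnd linear_sum; apply: eq_bigr => j _.
  rewrite exchange_big linear_sum; apply: eq_bigr => l _ /=.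
  by rewrite linearZ /= -scaler_sumr; congr (_ *: _); exact: bnd_ngen.
apply: (sum_antisym (D := D)) => [j j' jj'|j].
  have DE i i' : i != i' -> D i i' =
     \sum_(0 <= l < nfaces (tag x i)) \sum_(0 <= l' < nfaces (tag x i'))
       sgn (offset (tag x) i + l + (offset (idx_down (tag x) i) i' + l'))%N *:
       ngen K (face (face x i l) i' l').
    move=> ii'; apply: eq_bigr => l _; rewrite /dir_bnd scaler_sumr.
    rewrite [tag (face _ _ _) _]ffunE eq_sym (negPf ii') subn0.
    by apply: eq_bigr => l' _; rewrite scalerA -exprD.
  rewrite DE // DE 1?eq_sym // [in RHS]exchange_big -sumrN.
  apply: eq_big_nat => l /andP[_ lx]; rewrite -sumrN.
  apply: eq_big_nat => l' /andP[_ lx'] /=; rewrite face_comm // -scaleNr.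
  congr (_ *: _); rewrite -[RHS]mulN1r -exprS -signr_odd -[RHS]signr_odd; congr (_ ^+ _).
  move: lx lx'; rewrite !nfacesP => /andP[xj _] /andP[xj' _].
  rewrite -(offset_down j xj') -(offset_down j' xj).
  rewrite /= !oddD !oddb.
  move: (odd l) (odd l') (odd (offset (idx_down (tag x) j') j)).
  move: (odd (offset (idx_down (tag x) j) j')).
  case: (ltngtP j j') jj' => [_ _|_ _|/val_inj ->]; last by rewrite eqxx.
    by do 4!case.
  by do 4!case.
rewrite /D /dir_bnd /nfaces; case: (ltnP 0 (tag x j)) => xj; last by rewrite big_geq.
have tagE l : tag (face x j l) j = (tag x j).-1 by rewrite ffunE eqxx subn1.
have [xj1|xj1] := ltnP 1 (tag x j); last first.
  apply: big1 => l _; rewrite tagE.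
  by rewrite (_ : (0 < _)%N = false) ?big_geq ?scaler0 //; lia.
rewrite -[RHS](scaler0 _ (sgn (offset (tag x) j + offset (idx_down (tag x) j) j)%N)).
rewrite -[X in _ *: X](sum_simplicial
  (A := fun l l' => ngen K (face (face x j l) j l')) (N := tag x j)).
  rewrite scaler_sumr; apply: eq_bigr => l _.
  rewrite tagE -ltnS !prednK // xj1 !scaler_sumr.
  by apply: eq_bigr => l' _; rewrite !scalerA -!exprD; congr (sgn _ *: _);
    rewrite addnACA.
by move=> l l' l'l lx; rewrite face_face.
Qed.

End Boundary.

(** * The comparison map is a chain map *)

Section ProjectionChainMap.
Variables (K : comPzRingType) (R : realType) (T : topologicalType) (k : nat).
Variable k_gt0 : (0 < k)%N.
Local Notation idx := {ffun 'I_k -> nat}.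
Local Notation d1 := (dir1 k_gt0).
Local Notation proj := (@proj_simp R k k_gt0 T).
Local Notation N1 := (nchains K (sing R 1 T)).
Local Notation Nk := (nchains K (sing R k T)).
Local Notation f := (@proj_chain K R k k_gt0 T : chain N1 -> chain Nk).

Lemma crd_pi1 (n : {ffun 'I_1 -> nat}) (t : prod_simplex R (proj_idx k_gt0 n)) j c :
  crd (@pi1 R k k_gt0 n t) j c = crd t d1 c.
Proof.
rewrite /crd; apply: etrans (tcoord_push _ _ _ _ _) _; rewrite ?size_iota ?iota_sorted //.
- by rewrite ffunE eqxx (ord1 j).
- by apply/allP => i; rewrite mem_iota.
rewrite count_lt_iota subn0 (ord1 j).
by rewrite (_ : n ord0 = proj_idx k_gt0 n d1) ?tcoord_minn // ffunE eqxx.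
Qed.

Lemma proj_idx_eq0 n j : j != d1 -> proj_idx k_gt0 n j = 0%N.
Proof. by move=> /negPf jd; rewrite ffunE jd. Qed.

Lemma ev_proj x t : ev (proj x) t = ev x (pi1 t).
Proof. by []. Qed.

Lemma offset_dir1 n : offset n d1 = 0%N.
Proof. by rewrite /offset big1. Qed.

Definition idx1 (n : idx) : {ffun 'I_1 -> nat} := [ffun=> n d1].

(** The inclusion of the first factor at the last vertices of the others: pushing along
the empty sequence gives the point all of whose coordinates are 1. *)
Definition incl1 (n : idx) (t : prod_simplex R (idx1 n)) :
    prod_simplex R n :=
  fun j => simplex_map (n j) (if j == d1 then iota 0 (n j).+1 else [::]) (t ord0).

Lemma incl1_continuous n : continuous (@incl1 n).
Proof.
apply: continuous_prod => j t.
apply: (@continuous_comp _ _ _ (fun t : prod_simplex R _ => t ord0)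
  (simplex_map (n j) _)); last exact: simplex_map_continuous.
exact: (@proj_continuous _ (fun j : 'I_1 =>
  simplex R (idx1 n j)) ord0).
Qed.

Lemma crd_incl1 n t c : crd (@incl1 n t) d1 c = crd t ord0 c.
Proof.
rewrite /crd /incl1 eqxx; apply: etrans (tcoord_push _ _ _ _ _) _;
  rewrite ?size_iota ?iota_sorted //.
- by rewrite /idx1 ffunE.
- by apply/allP => i; rewrite mem_iota.
rewrite count_lt_iota subn0.
by rewrite [X in minn c X.+1](_ : _ = idx1 n ord0) ?tcoord_minn // ffunE.
Qed.

Definition restr1 (x : multisimplex (sing R k T)) : multisimplex (sing R 1 T) :=
  precomp (@incl1_continuous (tag x)).

Lemma ev_restr1 x t : ev (restr1 x) t = ev x (incl1 t).
Proof. by []. Qed.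

Lemma restr1_proj x : restr1 (proj x) = x.
Proof.
apply: sing_eq => [j|t u tu]; first by rewrite !ffunE eqxx (ord1 j).
rewrite ev_restr1 ev_proj; apply: ev_congr => j c.
by rewrite crd_pi1 crd_incl1 tu (ord1 j).
Qed.

Definition flat (x : multisimplex (sing R k T)) : Prop :=
  forall j, j != d1 -> tag x j = 0%N.

Lemma flat_proj x : flat (proj x).
Proof. by move=> j; exact: proj_idx_eq0. Qed.

Lemma proj_restr1 x : flat x -> proj (restr1 x) = x.
Proof.
move=> fx; apply: sing_eq => [j|t u tu].
  by rewrite !ffunE; case: eqVneq => [->|/fx].
rewrite ev_proj ev_restr1; apply: ev_congr => j c.
have [->|jd] := eqVneq j d1; first by rewrite crd_incl1 crd_pi1 tu.
by rewrite !crd_point ?fx.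
Qed.

(** A multisimplex can only be degenerate in a direction of positive dimension, which
for the image of a simplex is the first one. *)
Lemma degenerate_proj x : degenerate (proj x) <-> degenerate x.
Proof.
split=> /sing_degenerateP[j [i [ix hx]]].
  have jd : j = d1 by apply: contraPeq ix => /(flat_proj x) ->.
  subst j; rewrite -[x]restr1_proj; apply/sing_degenerateP; exists ord0, i.
  split=> [|t u tu]; first by rewrite ffunE.
  rewrite !ev_restr1; apply: hx => j c; rewrite xpair_eqE.
  have [->|jd _] := eqVneq j d1; last by rewrite !crd_point ?(flat_proj x).
  by move=> ci; rewrite !crd_incl1 tu // xpair_eqE.
apply/sing_degenerateP; exists d1, i; split.
  by move: ix; rewrite (ord1 j) ffunE eqxx.
move=> t u tu; rewrite !ev_proj; apply: hx => j' c.
by rewrite (ord1 j) (ord1 j') !crd_pi1 xpair_eqE eqxx => ci; rewrite tu // xpair_eqE eqxx.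
Qed.

Lemma proj_chain_ngen x : f (ngen K x) = ngen K (proj x).
Proof.
apply: (flin_ngen (F := fun x => ngen K (proj x))) => y dy.
by apply: ngen_degenerate; exact/degenerate_proj.
Qed.

Lemma face_proj (x : multisimplex (sing R 1 T)) l : (l < nfaces (tag x ord0))%N ->
  face (proj x) d1 l = proj (face x ord0 l).
Proof.
rewrite nfacesP => /andP[x0 lx].
have tagE : tag (proj x) d1 = tag x ord0 by rewrite ffunE eqxx.
apply: sing_eq => [j|t u tu].
  by rewrite !ffunE; case: eqVneq => //= _; rewrite subn0.
rewrite ev_face !ev_proj ev_face; apply: ev_congr => j c.
rewrite (ord1 j) crd_pi1 crd_face_map // eqxx crd_pi1.
by apply: etrans (@crd_face_map R T k (proj x) d1 l t d1 c _ _) _;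
  rewrite ?tagE // eqxx; exact: tu.
Qed.

Lemma dir_bnd_eq0 (x : multisimplex (sing R k T)) j : tag x j = 0%N -> dir_bnd K x j = 0.
Proof. by move=> xj; rewrite /dir_bnd xj big_geq. Qed.

Lemma bnd_proj_chain c : bnd (f c) = f (bnd c).
Proof.
move: c; apply: eq_linear => [| |b]; try by apply: comp_linear; exact: flin_linear.
rewrite -ngen_nval; move: (nval b) => {b} x; rewrite bnd_ngen proj_chain_ngen bnd_ngen.
rewrite (bigD1 d1) //= [X in _ + X]big1 ?addr0; last first.
  by move=> j jd; rewrite dir_bnd_eq0 // flat_proj.
rewrite big_ord1 /dir_bnd offset_dir1 [offset _ _]big1 //.
rewrite [tag (proj x) _]ffunE eqxx /f linear_sum.
apply: eq_big_nat => l /andP[_ lx]; rewrite linearZ /= -/f.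
by rewrite face_proj // -proj_chain_ngen.
Qed.

Lemma proj_chain_map : chain_map f.
Proof.
split=> [|n c hc|]; [exact: flin_linear | | exact: bnd_proj_chain].
apply: (supported_flin _ hc) => b bn.
apply: (supported_ngen (S := fun x => mdim (tag x) = n)).
rewrite -bn [RHS]/(mdim (tag (nval b))) /mdim [RHS]big_ord1 (bigD1 d1) //=.
rewrite big1 ?addn0 ?ffunE ?eqxx // => j jd.
exact: proj_idx_eq0.
Qed.

(** Restriction to the first factor is used as a linear retraction of [f]: it shows that
[f] is injective and that its image consists of the chains on flat multisimplices,
on which restriction then commutes with the boundary. *)
Definition restr_chain : chain Nk -> chain N1 :=
  flin (fun b => ngen K (restr1 (nval b))).

Lemma proj_chainK c : restr_chain (f c) = c.
Proof.
move: c; apply: (eq_linear (g := id)) => [| |b] //.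
  by apply: comp_linear; exact: flin_linear.
rewrite -ngen_nval proj_chain_ngen; case: (ngenP (proj (nval b))) => [[b' e]|].
  by rewrite -e ngen_nval /restr_chain flin_delta e restr1_proj.
by move=> /degenerate_proj d; case: b d => x /= /asboolPn.
Qed.

Lemma restr_chainK (c : chain Nk) :
  supported (fun b : nondeg _ => flat (nval b)) c -> f (restr_chain c) = c.
Proof.
move=> hc; rewrite /restr_chain /f flin_comp -[RHS]flin_fdelta.
apply: eq_flin_supported hc => b fb; rewrite -[LHS]/(f _) proj_chain_ngen.
by rewrite proj_restr1 // ngen_nval.
Qed.

Lemma homog_restr_chain n (c : chain Nk) :
  supported (fun b : nondeg _ => flat (nval b)) c -> homog n c ->
  homog n (restr_chain c).
Proof.
move=> fc hc.
have : supported (fun b : nondeg (sing R k T) => flat (nval b) /\ mdim (tag (nval b)) = n) c.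
  by move=> b cb; split; [exact: fc | exact: hc].
apply: supported_flin => b [fb <-].
apply: (supported_ngen (S := fun x => mdim (tag x) = _)).
rewrite /mdim big_ord1 [RHS](bigD1 d1) //= big1 ?addn0 ?ffunE //.
Qed.

Lemma bnd_restr_chain (c : chain Nk) :
  supported (fun b : nondeg _ => flat (nval b)) c ->
  bnd (restr_chain c) = restr_chain (bnd c).
Proof.
by move=> fc; rewrite -[LHS]proj_chainK -bnd_proj_chain restr_chainK.
Qed.

End ProjectionChainMap.

(** * The prism operators *)

Section Prisms.
Variables (R : realType) (T : topologicalType) (k : nat).
Variable d1 : 'I_k.
Local Notation idx := {ffun 'I_k -> nat}.
Implicit Types (n : idx) (x : multisimplex (sing R k T)) (j : 'I_k) (p : nat).

Lemma crd_continuous n j c : continuous (fun t : prod_simplex R n => crd t j c).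
Proof.
case: c => [|c]; rewrite /crd /=; first exact: cst_continuous.
case: insubP => [u _ _|_] /=; last exact: cst_continuous.
have ct : continuous (fun t : simplex R (n j) => val t ord0 u).
  move=> t; apply: (@continuous_comp _ _ _ (fun t : simplex R (n j) => val t)
    (fun v : 'rV[R]_(n j) => v ord0 u)); first exact: initial_continuous.
  exact: coord_continuous.
move=> t; apply: (@continuous_comp _ _ _ (fun t : prod_simplex R n => t j)
  (fun t : simplex R (n j) => val t ord0 u)); last exact: ct.
exact: (@proj_continuous _ (fun j => simplex R (n j)) j).
Qed.

Definition prism_row n p (t : prod_simplex R (idx_up n d1)) j : 'rV[R]_(n j) :=
  \row_i (if j == d1 then crd t d1 (bump p.+1 i.+1)
          else Num.min (crd t d1 p.+1) (crd t j i.+1)).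

Lemma prism_row_subproof n p t j : @prism_row n p t j \in simplex R (n j).
Proof.
have c01 i c : 0 <= crd t i c <= 1 by exact: tcoord01.
have cle i c d : (c <= d)%N -> crd t i d <= crd t i c by exact: tcoord_le.
apply/mem_set; split=> [i|i i' ii']; rewrite !mxE; case: eqVneq => // _.
- have /andP[a0 a1] := c01 d1 p.+1; have /andP[b0 b1] := c01 j i.+1.
  by rewrite le_min a0 b0 ge_min a1.
- by apply: cle; rewrite leq_bump2.
have le' : crd t j i'.+1 <= crd t j i.+1 by exact: cle.
by rewrite le_min !ge_min lexx le' orbT.
Qed.

(** In direction [d1] this is the p-th codegeneracy; the simplices in the other directions
are contracted to their zeroth vertices, the coordinate which the codegeneracy drops
serving as the time of the contraction. *)
Definition prism_map n p (t : prod_simplex R (idx_up n d1)) : prod_simplex R n :=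
  fun j => exist _ (prism_row p t j) (prism_row_subproof p t j).

Lemma prism_map_continuous n p : continuous (@prism_map n p).
Proof.
apply: continuous_prod => j; apply: continuous_comp_initial.
apply: continuous_row => i.
rewrite (_ : (fun _ => _) = fun t => if j == d1 then crd t d1 (bump p.+1 i.+1)
          else Num.min (crd t d1 p.+1) (crd t j i.+1)); last first.
  by apply/funext => t; rewrite /= mxE.
case: eqVneq => _; first exact: crd_continuous.
move=> t; apply: (@continuous_min _ _ (fun t : prod_simplex R _ => crd t d1 p.+1)
  (fun t : prod_simplex R _ => crd t j i.+1) t); exact: crd_continuous.
Qed.

Definition prism x p : multisimplex (sing R k T) :=
  precomp (@prism_map_continuous (tag x) p).

Definition prism_pt x p (t : prod_simplex R (tag (prism x p))) :
  prod_simplex R (tag x) := prism_map p t.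

Lemma ev_prism x p t : ev (prism x p) t = ev x (prism_pt t).
Proof. by []. Qed.

Lemma tag_prism x p j : tag (prism x p) j = (tag x j + (j == d1))%N.
Proof. by rewrite ffunE. Qed.

Lemma tag_prism1 x p : tag (prism x p) d1 = (tag x d1).+1.
Proof. by rewrite tag_prism eqxx addn1. Qed.

Lemma crd_prism1 x p (t : prod_simplex R (tag (prism x p))) c : (p <= tag x d1)%N ->
  crd (prism_pt t) d1 c = crd t d1 (bump p.+1 c).
Proof.
case: c => // c px; rewrite {1}/crd /=; case: insubP => [i _ ei|] /=.
  by rewrite mxE eqxx ei.
rewrite -leqNgt => xc; apply/esym/crd_over; rewrite (tag_prism1 x p) /bump.
have -> : (p.+1 <= c.+1)%N by exact: leq_trans px xc.
by rewrite add1n !ltnS.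
Qed.

Lemma crd_prism x p (t : prod_simplex R (tag (prism x p))) j c : j != d1 ->
  crd (prism_pt t) j c =
  if c == 0%N then 1 else Num.min (crd t d1 p.+1) (crd t j c).
Proof.
case: c => // c jd; rewrite {1}/crd /=; case: insubP => [i _ ei|] /=.
  by rewrite mxE (negPf jd) ei.
rewrite -leqNgt => xc; have t0 : crd t j c.+1 = 0.
  by apply: crd_over; rewrite (tag_prism x p) (negPf jd) addn0.
apply/esym; apply: etrans (congr1 (Num.min _) t0) _.
by apply/min_idPr; have /andP[] := tcoord01 (t d1) p.+1.
Qed.

Lemma face_prism_lt x p l : (l < p)%N -> (p <= tag x d1)%N ->
  face (prism x p) d1 l = prism (face x d1 l) p.-1.
Proof.
move=> lp px; have x0 : (0 < tag x d1)%N by lia.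
have lx : (l <= tag x d1)%N by lia.
have lx1 : (l <= (tag x d1).+1)%N by lia.
have px1 : (p.-1 <= (tag x d1).-1)%N by lia.
apply: sing_eq => [j|t u tu].
  rewrite tag_face !tag_prism tag_face addnK.
  by case: eqVneq => [->|_]; rewrite ?subnK //= subn0 addn0.
rewrite ev_face !ev_prism ev_face; apply: ev_congr => j c.
have [->|jd] := eqVneq j d1.
  rewrite crd_prism1 // !crd_face_map ?tag_prism1 //.
  rewrite eqxx crd_prism1 ?tag_face1 // tu; congr crd.
  by rewrite /bump /unbump; lia.
rewrite crd_prism // !crd_face_map ?tag_prism1 //.
rewrite (negPf jd) eqxx crd_prism // !tu.
by case: eqP => // _; congr (Num.min (crd _ _ _) _); rewrite /unbump; lia.
Qed.

Lemma face_prism_gt x p l : (p.+1 < l)%N -> (l <= (tag x d1).+1)%N ->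
  face (prism x p) d1 l = prism (face x d1 l.-1) p.
Proof.
move=> lp px; have x0 : (0 < tag x d1)%N by lia.
have px' : (p <= tag x d1)%N by lia.
have lx : (l.-1 <= tag x d1)%N by lia.
have px1 : (p <= (tag x d1).-1)%N by lia.
apply: sing_eq => [j|t u tu].
  rewrite tag_face !tag_prism tag_face addnK.
  by case: eqVneq => [->|_]; rewrite ?subnK //= subn0 addn0.
rewrite ev_face !ev_prism ev_face; apply: ev_congr => j c.
have [->|jd] := eqVneq j d1.
  rewrite crd_prism1 // !crd_face_map ?tag_prism1 //.
  rewrite eqxx crd_prism1 ?tag_face1 // tu; congr crd.
  by rewrite /bump /unbump; lia.
rewrite crd_prism // !crd_face_map ?tag_prism1 //.
rewrite (negPf jd) eqxx crd_prism // !tu.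
by case: eqP => // _; congr (Num.min (crd _ _ _) _); rewrite /unbump; lia.
Qed.

Lemma face_prism_mid x p : (p < tag x d1)%N ->
  face (prism x p) d1 p.+1 = face (prism x p.+1) d1 p.+1.
Proof.
move=> px; have px' := ltnW px.
apply: sing_eq => [j|t u tu].
  by rewrite !tag_face !tag_prism.
rewrite !ev_face !ev_prism; apply: ev_congr => j c.
have [->|jd] := eqVneq j d1.
  rewrite !crd_prism1 // !crd_face_map ?tag_prism1 //.
  by rewrite eqxx tu; congr crd; rewrite /bump /unbump; lia.
rewrite !crd_prism // !crd_face_map ?tag_prism1 //.
rewrite (negPf jd) eqxx !tu.
by case: eqP => // _; congr (Num.min (crd _ _ _) _); rewrite /unbump; lia.
Qed.

(** Time 1 leaves the other factors unchanged. *)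
Lemma face_prism_first x : face (prism x 0) d1 0 = x.
Proof.
apply: sing_eq => [j|t u tu].
  by rewrite tag_face tag_prism addnK.
rewrite ev_face ev_prism; apply: ev_congr => j c.
have [->|jd] := eqVneq j d1.
  rewrite crd_prism1 // crd_face_map ?tag_prism1 // eqxx tu; congr crd.
  by rewrite /bump /unbump; lia.
rewrite crd_prism // !crd_face_map ?tag_prism1 // eqxx (negPf jd) !tu crd0.
case: eqP => [->|_]; first by rewrite crd0.
by apply/min_idPr; have /andP[] := tcoord01 (u j) c.
Qed.

(** At time 0 every coordinate in a direction other than [d1] becomes 0, so the
multisimplex is constant in these directions. *)
Lemma face_prism_last x : (exists2 j, j != d1 & (0 < tag x j)%N) ->
  degenerate (face (prism x (tag x d1)) d1 (tag x d1).+1).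
Proof.
move=> [j jd xj]; apply/sing_degenerateP; exists j, 0%N.
split; first by rewrite tag_face tag_prism (negPf jd) addn0 subn0.
move=> t u tu; rewrite !ev_face !ev_prism; apply: ev_congr => j' c.
have [->|j'd] := eqVneq j' d1.
  rewrite !crd_prism1 // !crd_face_map ?tag_prism1 // eqxx.
  by apply: tu; rewrite xpair_eqE eq_sym (negPf jd).
rewrite !crd_prism // !crd_face_map ?tag_prism1 // eqxx (negPf j'd).
case: eqP => // _.
have over (v : prod_simplex R (tag (face (prism x (tag x d1)) d1 (tag x d1).+1))) :
    Num.min (crd v d1 (unbump (tag x d1).+1 (tag x d1).+1)) (crd v j' c) = 0.
  rewrite crd_over; last by rewrite tag_face1 tag_prism1 /unbump; lia.
  by apply/min_idPl; have /andP[] := tcoord01 (v j') c.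
by rewrite !over.
Qed.

(** If x ignores a coordinate in direction [d1], the prism ignores the coordinate which
replaces it after the shift by the dropped one; this is never the dropped coordinate
itself, on which the prism depends through the contraction. *)
Lemma prism_degenerate x p : (p <= tag x d1)%N -> degenerate x ->
  degenerate (prism x p).
Proof.
move=> px /sing_degenerateP[j [i [ix hx]]]; apply/sing_degenerateP.
have [jd|jd] := eqVneq j d1; last first.
  exists j, i; split; first by rewrite tag_prism (negPf jd) addn0.
  move=> t u tu; rewrite !ev_prism; apply: hx => j' c ci.
  have [j'd|j'd] := eqVneq j' d1.
    rewrite j'd !crd_prism1 //; apply: tu.
    by rewrite xpair_eqE eq_sym (negPf jd).
  rewrite !crd_prism //; case: eqP => // _; rewrite !tu //.
  by rewrite xpair_eqE eq_sym (negPf jd).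
subst j; exists d1, (bump p.+1 i.+1).-1; split.
  by rewrite tag_prism1 /bump; lia.
move=> t u tu; rewrite !ev_prism; apply: hx => j c.
have [->|jd _] := eqVneq j d1.
  rewrite xpair_eqE eqxx /= => ci; rewrite !crd_prism1 //; apply: tu.
  by rewrite xpair_eqE eqxx /=; move: ci; rewrite /bump; lia.
rewrite !crd_prism //; case: eqP => // _; rewrite !tu //.
  by rewrite xpair_eqE (negPf jd).
by rewrite xpair_eqE eqxx /= /bump; lia.
Qed.

(** With nothing to contract, the dropped coordinate is not used at all. *)
Lemma prism_flat x p : (p <= tag x d1)%N -> (forall j, j != d1 -> tag x j = 0%N) ->
  degenerate (prism x p).
Proof.
move=> px fx; apply/sing_degenerateP; exists d1, p.
split; first by rewrite tag_prism1.
move=> t u tu; rewrite !ev_prism; apply: ev_congr => j c.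
have [->|jd] := eqVneq j d1; last by rewrite !crd_point ?fx.
by rewrite !crd_prism1 // tu // xpair_eqE eqxx eq_sym neq_bump.
Qed.

End Prisms.

(** * The prism homotopy *)

Section PrismHomotopy.
Variables (K : comPzRingType) (R : realType) (T : topologicalType) (k : nat).
Variable k_gt0 : (0 < k)%N.
Local Notation d1 := (dir1 k_gt0).
Local Notation Nk := (nchains K (sing R k T)).
Local Notation prism := (prism d1).
Implicit Types (x : multisimplex (sing R k T)) (j : 'I_k) (c : chain Nk).
Local Notation sgn := (fun n => (-1) ^+ n : K).

Definition prism_sum x : chain Nk :=
  \sum_(0 <= p < (tag x d1).+1) sgn p *: ngen K (prism x p).

Definition prism_chain : chain Nk -> chain Nk := flin (fun b => prism_sum (nval b)).

Lemma prism_chain_linear : linear prism_chain.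
Proof. exact: flin_linear. Qed.

Lemma prism_chain_ngen x : prism_chain (ngen K x) = prism_sum x.
Proof.
apply: (flin_ngen (F := prism_sum)) => y dy.
rewrite /prism_sum big_nat big1 // => p /andP[_ py].
by rewrite ngen_degenerate ?scaler0 //; apply: prism_degenerate.
Qed.

Lemma prism_sum_flat x : flat k_gt0 x -> prism_sum x = 0.
Proof.
move=> fx; rewrite /prism_sum big_nat big1 // => p /andP[_ py].
by rewrite ngen_degenerate ?scaler0 //; apply: prism_flat.
Qed.

(** The first direction alone: the prism homotopy relates the identity to the
restriction to zeroth vertices, which vanishes on x. *)
Lemma prism_homotopy1 x : ~ flat k_gt0 x ->
  \sum_(0 <= p < (tag x d1).+1) sgn p *: dir_bnd K (prism x p) d1 +
  \sum_(0 <= l < nfaces (tag x d1)) sgn l *: prism_sum (face x d1 l) = ngen K x.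
Proof.
move=> nfx; set n := tag x d1.
pose A p l := ngen K (face (prism x p) d1 l).
pose B l p := ngen K (prism (face x d1 l) p).
pose r p := if (p <= n)%N then ngen K (face (prism x p) d1 p)
            else ngen K (face (prism x n) d1 n.+1).
have <- : r 0%N - r n.+1 = ngen K x.
  rewrite /r ltnn leq0n face_prism_first (@ngen_degenerate _ _ _ (face _ _ _)) ?subr0 //.
  apply: face_prism_last; apply: contra_notP nfx => h j jd.
  by apply/eqP; rewrite -leqn0 leqNgt; apply/negP => xj; apply: h; exists j.
rewrite -(@sum_prism _ _ n A B r).
- congr (_ + _).
    apply: eq_big_nat => p /andP[_ px]; rewrite scaler_sumr offset_dir1.
    rewrite tag_prism1; apply: eq_bigr => l _.
    by rewrite scalerA -exprD.
  rewrite /nfaces -/n; case: (posnP n) => n0.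
    by rewrite n0 /= big_geq // big1 // => l _; rewrite big_geq.
  apply: eq_big_nat => l /andP[_ lx]; rewrite scaler_sumr.
  rewrite tag_face1 -/n prednK //; apply: eq_bigr => p _.
  by rewrite scalerA -exprD addnC.
- by move=> p l lp px; rewrite /A /B face_prism_lt.
- by move=> p l lp px; rewrite /A /B face_prism_gt.
- by move=> p px; rewrite /r px.
move=> p px; rewrite /r; case: ltnP => pn; first by rewrite /A face_prism_mid.
by rewrite (_ : p = n) //; apply/eqP; rewrite eqn_leq px.
Qed.

Definition codim x : nat := \sum_(j < k | j != d1) tag x j.

Lemma codim_prism x p : codim (prism x p) = codim x.
Proof.
by apply: eq_bigr => j /negPf jd; rewrite (tag_prism d1 x p) jd addn0.
Qed.

Lemma codim_face x j l : (l < nfaces (tag x j))%N -> j != d1 ->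
  (codim (face x j l)).+1 = codim x.
Proof.
rewrite nfacesP => /andP[xj _] jd.
rewrite /codim (bigD1 j) // [RHS](bigD1 j) // (tag_face1 x j l) -addSn prednK //.
congr (_ + _)%N; apply: eq_bigr => i /andP[_ /negPf ij].
by rewrite (tag_face x j l) ij subn0.
Qed.

Lemma codim_face1 x l : codim (face x d1 l) = codim x.
Proof. by apply: eq_bigr => i /negPf id; rewrite (tag_face x) id subn0. Qed.

Lemma codim_flat x : flat k_gt0 x <-> codim x = 0%N.
Proof.
split=> [fx|/eqP]; first by apply: big1.
by rewrite sum_nat_eq0 => /forall_inP h j /h/eqP.
Qed.

Lemma mdim_prism x p : mdim (tag (prism x p)) = (mdim (tag x)).+1.
Proof.
rewrite /mdim (bigD1 d1) // [in RHS](bigD1 d1) //.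
rewrite [LHS]/(tag (prism x p) d1 + codim (prism x p))%N.
by rewrite codim_prism tag_prism1.
Qed.

Lemma mdim_face x j l : (l < nfaces (tag x j))%N ->
  (mdim (tag (face x j l))).+1 = mdim (tag x).
Proof.
rewrite nfacesP => /andP[xj _].
rewrite /mdim (bigD1 j) // [RHS](bigD1 j) // (tag_face1 x j l) -addSn prednK //.
congr (_ + _)%N; apply: eq_bigr => i /negPf ij.
by rewrite (tag_face x j l) ij subn0.
Qed.

Definition chain_on (S : multisimplex (sing R k T) -> Prop) c : Prop :=
  supported (fun b : nondeg _ => S (nval b)) c.

Lemma on_dir_bnd (S : multisimplex (sing R k T) -> Prop) x j :
  (forall l, (l < nfaces (tag x j))%N -> S (face x j l)) -> chain_on S (dir_bnd K x j).
Proof.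
move=> h; rewrite /dir_bnd big_seq; apply: supported_sum => l.
rewrite mem_index_iota => /andP[_ lx]; apply: supportedZ.
by apply: supported_ngen; exact: h.
Qed.

Lemma on_prism_sum (S : multisimplex (sing R k T) -> Prop) x :
  (forall p, S (prism x p)) -> chain_on S (prism_sum x).
Proof.
move=> h; apply: supported_sum => p _; apply: supportedZ.
exact: supported_ngen.
Qed.

Lemma on_bnd (S S' : multisimplex (sing R k T) -> Prop) c :
  (forall x j l, S x -> (l < nfaces (tag x j))%N -> S' (face x j l)) ->
  chain_on S c -> chain_on S' (bnd c).
Proof.
move=> h; apply: supported_flin => b Sb.
rewrite [X in supported _ X](bdiffE _ b).
by apply: supported_sum => j _; apply: on_dir_bnd => l; exact: h.
Qed.

Lemma on_prism_chain (S S' : multisimplex (sing R k T) -> Prop) c :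
  (forall x p, S x -> S' (prism x p)) -> chain_on S c -> chain_on S' (prism_chain c).
Proof.
by move=> h; apply: supported_flin => b Sb; apply: on_prism_sum => p; exact: h.
Qed.

(** Chain homotopic to the identity, and lowering [codim] on chains that are not
flat. *)
Definition descend c : chain Nk := c - bnd (prism_chain c) - prism_chain (bnd c).

Lemma descend_linear : linear descend.
Proof.
have lb : linear (@bnd K Nk) by exact: flin_linear.
move=> a u v; rewrite /descend prism_chain_linear !lb prism_chain_linear.
rewrite !scalerBr !opprD !addrA; do 2!rewrite [in LHS](addrAC _ v).
by rewrite !(addrAC _ _ v) (addrAC _ (- bnd (prism_chain v))).
Qed.

(** On a generator that is not flat, the component of d P + P d in direction [d1] is the
identity, and the others take faces in a direction counted by [codim]. *)
Lemma on_descend M c : chain_on (fun x => (codim x <= M.+1)%N) c ->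
  chain_on (fun x => (codim x <= M)%N) (descend c).
Proof.
move=> hc; rewrite (linear_flin _ descend_linear).
apply: supported_flin hc => b; rewrite -ngen_nval; move: (nval b) => {b} x xM.
rewrite /descend prism_chain_ngen bnd_ngen.
have [fx|nfx] := pselect (flat k_gt0 x).
  have Pd0 : prism_chain (\sum_j dir_bnd K x j) = 0.
    rewrite (bigD1 d1) //= big1 => [|j /fx]; last exact: dir_bnd_eq0.
    rewrite addr0 /prism_chain linear_sum big_nat big1 // => l lx.
    rewrite linearZ /= -/(prism_chain _) prism_chain_ngen prism_sum_flat ?scaler0 //.
    by apply/codim_flat; rewrite codim_face1; apply/codim_flat.
  rewrite prism_sum_flat // /bnd linear0 subr0 Pd0 subr0.
  apply: (supported_ngen (S := fun x => codim x <= M)%N).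
  by move/codim_flat: fx => ->.
pose D1 := \sum_(0 <= p < (tag x d1).+1) sgn p *: \sum_(j | j != d1) dir_bnd K (prism x p) j.
pose D2 := \sum_(j | j != d1) prism_chain (dir_bnd K x j).
suff -> : ngen K x - bnd (prism_sum x) - prism_chain (\sum_j dir_bnd K x j) = - D1 - D2.
  apply: supportedD; apply: supportedN.
    apply: supported_sum => p _; apply: supportedZ; apply: supported_sum => j jd.
    apply: (on_dir_bnd (S := fun x => codim x <= M)%N) => l lx.
    by rewrite -ltnS codim_face // codim_prism.
  apply: supported_sum => j jd.
  apply: (@on_prism_chain (fun x => codim x <= M)%N (fun x => codim x <= M)%N) => [y p yM|].
    by rewrite codim_prism.
  by apply: on_dir_bnd => l lx; rewrite -ltnS codim_face.
rewrite -{1}(prism_homotopy1 nfx).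
have -> : bnd (prism_sum x) =
  \sum_(0 <= p < (tag x d1).+1) sgn p *: dir_bnd K (prism x p) d1 + D1.
  rewrite /bnd linear_sum -big_split; apply: eq_bigr => p _ /=.
  rewrite linearZ /= -scalerDr; congr (_ *: _).
  by apply: etrans (bnd_ngen K (prism x p)) _; exact: bigD1.
have -> : prism_chain (\sum_j dir_bnd K x j) =
  \sum_(0 <= l < nfaces (tag x d1)) sgn l *: prism_sum (face x d1 l) + D2.
  rewrite /prism_chain linear_sum (bigD1 d1) //=; congr (_ + _).
  rewrite /dir_bnd linear_sum; apply: eq_bigr => l _.
  by rewrite linearZ /= -/(prism_chain _) prism_chain_ngen offset_dir1.
by rewrite -addrA -opprD [X in _ - X]addrACA opprD addrA subrr add0r opprD.
Qed.

Lemma homog_descend n c : homog n c -> homog n (descend c).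
Proof.
move=> hc; apply: supportedD; first apply: supportedD => //; apply: supportedN.
  apply: (@on_bnd (fun x => mdim (tag x) = n.+1) (fun x => mdim (tag x) = n)).
    by move=> x j l xn lx; apply: succn_inj; rewrite mdim_face.
  apply: (@on_prism_chain (fun x => mdim (tag x) = n) _ _ _ hc) => x p.
  by rewrite mdim_prism => ->.
apply: (@on_prism_chain (fun x => (mdim (tag x)).+1 = n) (fun x => mdim (tag x) = n)).
  by move=> x p; rewrite mdim_prism.
by apply: (@on_bnd (fun x => mdim (tag x) = n) _ _ _ hc) => x j l xn lx; rewrite mdim_face.
Qed.

Lemma homog_prism_chain n c : homog n c -> homog n.+1 (prism_chain c).
Proof.
move=> hc; apply: (@on_prism_chain (fun x => mdim (tag x) = n)
  (fun x => mdim (tag x) = n.+1)) hc => x p; rewrite mdim_prism.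
by move=> ->.
Qed.

Lemma codim_le_mdim x : (codim x <= mdim (tag x))%N.
Proof. by rewrite /mdim (bigD1 d1) //= leq_addl. Qed.

Lemma on_codim_mdim n c : homog n c -> chain_on (fun x => (codim x <= n)%N) c.
Proof. by apply: sub_supported => b <-; exact: codim_le_mdim. Qed.

Lemma on_flat c : chain_on (fun x => (codim x <= 0)%N) c -> chain_on (flat k_gt0) c.
Proof. by apply: sub_supported => b; rewrite leqn0 => /eqP/codim_flat. Qed.

(** On a cycle z, [descend] subtracts the boundary of the prism chain of z; it reaches a
flat cycle after as many steps as z has dimensions. *)
Lemma flat_cycle n c : homog n c -> bnd c = 0 ->
  exists e, [/\ homog n.+1 e, homog n (c - bnd e) & chain_on (flat k_gt0) (c - bnd e)].
Proof.
move=> hc; have [M cM] : exists M, chain_on (fun x => codim x <= M)%N c.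
  by exists n; exact: on_codim_mdim.
elim: M c hc cM => [|M IH] c hc cM zc.
  exists 0; rewrite bnd0 subr0; split => //; first exact: supported0.
  exact: on_flat.
have fE : descend c = c - bnd (prism_chain c).
  by rewrite /descend zc /prism_chain linear0 subr0.
have zf : bnd (descend c) = 0.
  by rewrite fE bndB bnd_bnd zc subr0.
have [e [he h1 h2]] := IH _ (homog_descend hc) (on_descend cM) zf.
exists (prism_chain c + e).
have -> : c - bnd (prism_chain c + e) = descend c - bnd e.
  by rewrite fE bndD opprD addrA.
by split => //; apply: supportedD => //; exact: homog_prism_chain.
Qed.

(** The prism operator kills the flat chain [bnd c], so applying [descend] to c does not
change its boundary. *)
Lemma flat_boundary n c : homog n c -> chain_on (flat k_gt0) (bnd c) ->
  exists c', [/\ homog n c', chain_on (flat k_gt0) c' & bnd c' = bnd c].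
Proof.
move=> hc; have [M cM] : exists M, chain_on (fun x => codim x <= M)%N c.
  by exists n; exact: on_codim_mdim.
elim: M c hc cM => [|M IH] c hc cM fc.
  by exists c; split => //; exact: on_flat.
have P0 : prism_chain (bnd c) = 0.
  rewrite /prism_chain (eq_flin_supported (psi := fun=> 0) _ fc) => [|b fb].
    by rewrite /flin fsbig1 // => b _; rewrite scaler0.
  exact: prism_sum_flat.
have bE : bnd (descend c) = bnd c.
  by rewrite /descend P0 subr0 bndB bnd_bnd subr0.
have [|c' [h1 h2 h3]] := IH _ (homog_descend hc) (on_descend cM).
  by rewrite bE.
by exists c'; split => //; rewrite h3.
Qed.

End PrismHomotopy.

(** * The comparison map is a quasi-isomorphism *)

Section QuasiIsomorphisms.
Variable K : comPzRingType.

Lemma homologyP (C : bcomplex K) n (u v : cycle C n) :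
  \pi_(homology C n) u = \pi_(homology C n) v <->
  exists2 b, homog n.+1 b & bnd b = cval u - cval v.
Proof.
split=> [/eqP|[b hb eb]].
  by rewrite -Quotient.idealrBE => /asboolP[b hb eb]; exists b.
by apply/eqP; rewrite -Quotient.idealrBE; apply/asboolP; exists b.
Qed.

Lemma cycleP (C : bcomplex K) n (z : cycle C n) : homog n (cval z) /\ bnd (cval z) = 0.
Proof. by case: z => z /= /asboolP. Qed.

Lemma inj_surj_bijective (A B : Type) (g : A -> B) :
  injective g -> (forall b, exists a, g a = b) -> bijective g.
Proof.
move=> gi /choice[h hK]; exists h => // a.
by apply: gi; rewrite hK.
Qed.

Lemma chain_mapB (C D : bcomplex K) (f : chain C -> chain D) u v :
  chain_map f -> f (u - v) = f u - f v.
Proof.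
move=> /chain_map_linear lf.
by rewrite addrC -scaleN1r lf scaleN1r addrC.
Qed.

(** Bijectivity on homology in terms of chains; the hypotheses spare the choice of
representatives in the definition of the induced map. *)
Lemma quasi_isoP (C D : bcomplex K) (f : chain C -> chain D) :
  chain_map f ->
  (forall n c e, homog n c -> bnd c = 0 -> homog n.+1 e -> bnd e = f c ->
    exists2 e', homog n.+1 e' & bnd e' = c) ->
  (forall n d, homog n d -> bnd d = 0 ->
    exists c e, [/\ homog n c, bnd c = 0, homog n.+1 e & bnd e = f c - d]) ->
  quasi_iso f.
Proof.
move=> hf hinj hsurj; exists hf => n; apply: inj_surj_bijective => [g h|h].
  rewrite /homology_map => /homologyP[e he ee].
  rewrite -[g]reprK -[h]reprK; apply/homologyP; move: (repr g) (repr h) ee => u v ee.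
  have [hu zu] := cycleP u; have [hv zv] := cycleP v.
  apply: (hinj n (cval u - cval v) e) => //.
  - by apply: supportedD => //; exact: supportedN.
  - by rewrite bndB zu zv subr0.
  - by rewrite ee (chain_mapB _ _ hf).
have [hd zd] := cycleP (repr h).
have [c [e [hc zc he ee]]] := hsurj n _ hd zd.
(* the induced map is computed on a representative, which differs from c by the
   boundary of b below *)
have cz : c \in is_cycle C n by apply/asboolP.
exists (\pi_(homology C n) (Cycle cz)); rewrite -[h]reprK /homology_map.
apply/homologyP.
have /homologyP[b hb eb] : \pi_(homology C n) (repr (\pi_(homology C n) (Cycle cz))) =
   \pi_(homology C n) (Cycle cz) by rewrite reprK.
exists (f b + e).
  by apply: supportedD => //; exact: chain_map_homog.
rewrite bndD ee (chain_map_bnd hf) eb (chain_mapB _ _ hf) addrA.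
by rewrite [cval (Cycle cz)]/= subrK.
Qed.

End QuasiIsomorphisms.

Lemma proj_chain_quasi_iso (K : comPzRingType) (R : realType) (k : nat)
    (k_gt0 : (0 < k)%N) (T : topologicalType) :
  quasi_iso (@proj_chain K R k k_gt0 T).
Proof.
have hf := proj_chain_map K R T k_gt0.
have restr0 : restr_chain k_gt0 (0 : chain (nchains K (sing R k T))) = 0 by exact: linear0.
apply: quasi_isoP => // [n c e hc zc he ee|n d hd zd].
  have fl : chain_on (flat k_gt0) (bnd e).
    rewrite ee; apply: (@supported_flin _ _ _ (fun=> True)) => // b _.
    by apply: supported_ngen; exact: flat_proj.
  have [e' [he' fe' ee']] := flat_boundary he fl.
  exists (restr_chain k_gt0 e'); first exact: homog_restr_chain.
  by rewrite bnd_restr_chain // ee' ee proj_chainK.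
have [e [he hde fde]] := flat_cycle k_gt0 hd zd.
exists (restr_chain k_gt0 (d - bnd e)), (- e); split.
- exact: homog_restr_chain.
- by rewrite bnd_restr_chain // bndB bnd_bnd zd subr0.
- exact: supportedN.
by rewrite restr_chainK // -[- e]sub0r bndB bnd0 sub0r addrAC subrr sub0r.
Qed.

(** * Tensor powers of linear maps *)

Section TensorPowers.
Variable K : comPzRingType.

Section Product.
Variable B : choiceType.
Implicit Types s t u : freemod K (seq B).

Lemma tmul_delta (u v : seq B) :
  tmul (fdelta u) (fdelta v) = fdelta (u ++ v) :> freemod K (seq B).
Proof. by rewrite /tmul !flin_delta. Qed.

Lemma tmul_linearl t : linear (fun s => tmul s t).
Proof. exact: flin_linear. Qed.

Lemma tmul_linearr s : linear (tmul s).
Proof.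
move=> a u v; rewrite /tmul.
move: s; apply: eq_linear => [||w]; first exact: flin_linear.
  by move=> b c d; rewrite !linearP /= !scalerA [b * a]mulrC addrACA.
by rewrite !flin_delta linearP.
Qed.

Lemma eq_linear2 (V : lmodType K) (f g : freemod K (seq B) -> freemod K (seq B) -> V) :
  (forall t, linear (f^~ t)) -> (forall s, linear (f s)) ->
  (forall t, linear (g^~ t)) -> (forall s, linear (g s)) ->
  (forall u v : seq B, f (fdelta u) (fdelta v) = g (fdelta u) (fdelta v)) -> f =2 g.
Proof.
move=> fl fr gl gr e s t; move: s; apply: eq_linear => // u.
by move: t; apply: eq_linear.
Qed.

Lemma tmulA : associative (@tmul K B).
Proof.
move=> s t u; move: t u; apply: eq_linear2 => [u|t|u|t|t u].
- exact: comp_linear (tmul_linearr s) (tmul_linearl u).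
- exact: comp_linear (tmul_linearr s) (tmul_linearr t).
- exact: comp_linear (tmul_linearl u) (tmul_linearr s).
- exact: tmul_linearr.
move: s; apply: eq_linear => [||s]; first exact: tmul_linearl.
  exact: comp_linear (tmul_linearl _) (tmul_linearl _).
by rewrite !tmul_delta catA.
Qed.

Lemma tmul1l : left_id (fdelta [::]) (@tmul K B).
Proof.
move=> t; move: t; apply: (eq_linear (g := id)) => [||t] //; first exact: tmul_linearr.
by rewrite tmul_delta.
Qed.

Lemma tmul1r : right_id (fdelta [::]) (@tmul K B).
Proof.
move=> t; move: t; apply: (eq_linear (g := id)) => [||t] //; first exact: tmul_linearl.
by rewrite tmul_delta cats0.
Qed.

End Product.

Lemma flin_map_tmul (B B' : choiceType) (h : B -> B') (s t : freemod K (seq B)) :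
  flin (fun w => fdelta (map h w)) (tmul s t) =
  tmul (flin (fun w => fdelta (map h w)) s) (flin (fun w => fdelta (map h w)) t)
    :> freemod K (seq B').
Proof.
have lJ : linear (flin (fun w : seq B => fdelta (map h w) : freemod K (seq B'))).
  exact: flin_linear.
move: s t; apply: eq_linear2 => [t|s|t|s|u v].
- exact: comp_linear lJ (tmul_linearl t).
- exact: comp_linear lJ (tmul_linearr s).
- exact: comp_linear (tmul_linearl _) lJ.
- exact: comp_linear (tmul_linearr _) lJ.
by rewrite !flin_delta !tmul_delta flin_delta map_cat.
Qed.

Section Powers.
Variables (B B' : choiceType).
Implicit Types phi : B -> freemod K B'.

Lemma tpow_linear phi : linear (tpow phi).
Proof. exact: flin_linear. Qed.

Lemma tpow_nil phi : tpow phi (fdelta [::]) = fdelta [::].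
Proof. by rewrite /tpow flin_delta. Qed.

Lemma tpow_cons phi b w :
  tpow phi (fdelta (b :: w)) =
  tmul (flin (fun b' => fdelta [:: b']) (phi b)) (tpow phi (fdelta w)).
Proof. by rewrite /tpow !flin_delta. Qed.

(** The tensor power is multiplicative for concatenation, hence functorial
([tpow_comp]). *)
Lemma tpow_tmul phi s t : tpow phi (tmul s t) = tmul (tpow phi s) (tpow phi t).
Proof.
move: s t; apply: eq_linear2 => [t|s|t|s|u v].
- exact: comp_linear (tpow_linear _) (tmul_linearl t).
- exact: comp_linear (tpow_linear _) (tmul_linearr s).
- exact: comp_linear (tmul_linearl _) (tpow_linear _).
- exact: comp_linear (tmul_linearr _) (tpow_linear _).
rewrite tmul_delta; elim: u => [|b u IH]; first by rewrite tpow_nil tmul1l.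
by rewrite cat_cons !tpow_cons IH tmulA.
Qed.

Lemma eq_tpow phi phi' : phi =1 phi' -> tpow phi =1 tpow phi'.
Proof. by move=> /funext ->. Qed.

End Powers.

Lemma tpow_comp (B B' B'' : choiceType) (psi : B' -> freemod K B'')
    (phi : B -> freemod K B') c :
  tpow psi (tpow phi c) = tpow (fun b => flin psi (phi b)) c.
Proof.
move: c; apply: eq_linear => [||w]; last elim: w => [|b w IH].
- exact: comp_linear (tpow_linear _) (tpow_linear _).
- exact: tpow_linear.
- by rewrite !tpow_nil.
rewrite !tpow_cons tpow_tmul IH; congr tmul.
move: (phi b); apply: eq_linear => [||b'].
- by apply: comp_linear; [exact: tpow_linear | exact: flin_linear].
- by apply: comp_linear; exact: flin_linear.
by rewrite !flin_delta tpow_cons tpow_nil tmul1r.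
Qed.

Lemma tpow_map (B B' B'' : choiceType) (phi : B' -> freemod K B'') (h : B -> B') c :
  tpow phi (flin (fun w => fdelta (map h w)) c) = tpow (fun b => phi (h b)) c.
Proof.
move: c; apply: eq_linear => [||w].
- by apply: comp_linear; [exact: tpow_linear | exact: flin_linear].
- exact: tpow_linear.
rewrite flin_delta; elim: w => [|b w IH] /=; first by rewrite !tpow_nil.
by rewrite !tpow_cons IH.
Qed.

End TensorPowers.

(** * Operations on simplices padded by points *)

Section PaddedCells.
Variable K : comPzRingType.
Local Notation simp := (seq nat).

(** The generator v (x) [0] (x) ... (x) [0] for the product of a simplex with m points. *)
Definition pad m (v : simp) : cell := v :: nseq m [:: 0%N].

Lemma cdim_points m : cdim (nseq m [:: 0%N]) = 0%N.
Proof. by elim: m. Qed.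

Lemma ceps_points m : ceps K (nseq m [:: 0%N]) = 1.
Proof. by elim: m => [|m IH]; rewrite /ceps ?big_nil //= big_cons mul1r. Qed.

Lemma coprod_points m :
  coprod K (nseq m [:: 0%N]) = fdelta (nseq m [:: 0%N], nseq m [:: 0%N]).
Proof.
elim: m => //= m ->; rewrite big_ord1 flin_delta /=.
by rewrite cdim_points muln0 expr0 scale1r.
Qed.

Lemma cdim_pad m v : cdim (pad m v) = vdim v.
Proof. by rewrite /cdim /= -/(cdim _) cdim_points addn0. Qed.

Lemma ceps_pad m v : ceps K (pad m v) = veps K v.
Proof. by rewrite /ceps big_cons -/(ceps _ _) ceps_points mulr1. Qed.

Lemma coprod_pad m v :
  coprod K (pad m v) =
  \sum_(i < size v) fdelta (pad m (take i.+1 v), pad m (drop i v)).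
Proof.
rewrite /= coprod_points; apply: eq_bigr => i _; rewrite flin_delta /=.
by rewrite cdim_points muln0 expr0 scale1r.
Qed.

(** In the sum defining the join, the summands that join two points vanish. *)
Lemma cjoin_pad m v w :
  cjoin K (pad m v) (pad m w) = flin (fun z => fdelta (pad m z)) (vjoin K v w).
Proof.
rewrite /cjoin big_ord_recl [X in _ + X]big1 ?addr0 => [|i _] /=; last first.
  have im : (i < m)%N by rewrite -[X in (_ < X)%N](size_nseq m [:: 0%N]).
  by rewrite !nth_nseq im /vjoin /= linear0 scaler0.
rewrite drop0 !ceps_points /cdim /ceps /= big_nil expr0 !mulr1 scale1r.
by apply: eq_flin.
Qed.

End PaddedCells.

Section PaddedOperations.
Variable K : comPzRingType.
Local Notation simp := (seq nat).

Definition swdim (w : seq simp) : nat := sumn [seq vdim v | v <- w].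

(** The operations on the chains of a single simplex, with the numbers of factors left
out: [mdenote] on k factors is this function for every k, up to padding. *)
Fixpoint sdenote (t : mterm K) (w : seq simp) : freemod K (seq simp) :=
  match t with
  | mone n => fdelta w
  | mswap m n =>
      (-1) ^+ (swdim (take m w) * swdim (drop m w)) *:
      fdelta (drop m w ++ take m w)
  | mcop => let v := nth [::] w 0 in
      \sum_(i < size v) fdelta [:: take i.+1 v; drop i v]
  | mcou => veps K (nth [::] w 0) *: fdelta [::]
  | mjoin => flin (fun z => fdelta [:: z]) (vjoin K (nth [::] w 0) (nth [::] w 1))
  | mafter g f => flin (sdenote g) (sdenote f w)
  | mtens f g =>
      (-1) ^+ (tdeg g * swdim (take (tin f) w)) *:
      tmul (sdenote f (take (tin f) w)) (sdenote g (drop (tin f) w))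
  | mzero _ _ _ => 0
  | madd f g => sdenote f w + sdenote g w
  | mscale a f => a *: sdenote f w
  end.

Lemma supported_tmul (B : choiceType) (S S' S'' : seq B -> Prop)
    (s t : freemod K (seq B)) :
  (forall u v, S u -> S' v -> S'' (u ++ v)) ->
  supported S s -> supported S' t -> supported S'' (tmul s t).
Proof.
move=> h hs ht; apply: supported_flin hs => u Su.
by apply: supported_flin ht => v Sv; apply: supported_delta; exact: h.
Qed.

Lemma size_sdenote t w : well_formed t -> size w = tin t ->
  supported (fun w' => size w' = tout t) (sdenote t w).
Proof.
elim: t w => [n|m n||||g IHg f IHf|f IHf g IHg|m n d|f IHf g IHg|a f IHf] w /=.
- by move=> _ wn; exact: supported_delta.
- move=> _ wn; apply: supportedZ; apply: supported_delta.
  by rewrite size_cat size_drop size_take_min wn; lia.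
- by move=> _ _; apply: supported_sum => i _; exact: supported_delta.
- by move=> _ _; apply: supportedZ; exact: supported_delta.
- move=> _ _; apply: (@supported_flin _ _ _ (fun=> True)) => // z _.
  exact: supported_delta.
- move=> /and3P[wg wf /eqP gf] ws; apply: supported_flin (IHf _ wf ws) => u uf.
  by apply: IHg; rewrite // uf gf.
- move=> /andP[wf wg] ws; apply: supportedZ.
  apply: (@supported_tmul _ (fun u => size u = tout f) (fun u => size u = tout g)).
  + by move=> u v uf vg; rewrite size_cat uf vg.
  + by apply: IHf; rewrite // size_take_min ws; lia.
  + by apply: IHg; rewrite // size_drop ws; lia.
- by move=> _ _; exact: supported0.
- move=> /and3P[wf wg /and3P[/eqP ei /eqP eo _]] ws; apply: supportedD.
    exact: IHf.
  by rewrite eo; apply: IHg; rewrite // -ei.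
- by move=> wf ws; apply: supportedZ; exact: IHf.
Qed.

Lemma wdim_pad m w : wdim (map (pad m) w) = swdim w.
Proof.
by rewrite /wdim /swdim -map_comp; congr sumn; apply: eq_map => v; exact: cdim_pad.
Qed.

(** For a composite, the intermediate words must have the arity expected by the outer
operation, since an operation reads missing factors as empty cells, which are not
padded; this is what [size_sdenote] provides. *)
Lemma mdenote_pad m t w : well_formed t -> size w = tin t ->
  mdenote t (map (pad m) w) = flin (fun w' => fdelta (map (pad m) w')) (sdenote t w).
Proof.
elim: t w => [n|p n||||g IHg f IHf|f IHf g IHg|p n d|f IHf g IHg|a f IHf] w /=.
- by move=> _ _; rewrite flin_delta.
- move=> _ wn; rewrite linearZ /= flin_delta map_cat -!map_take -!map_drop.
  by rewrite !wdim_pad.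
- case: w => [|v [|]] //= _ _; rewrite -/(pad m v) -[X in flin _ X]/(coprod K (pad m v)).
  rewrite coprod_pad !linear_sum; apply: eq_bigr => i _.
  by rewrite /= !flin_delta.
- case: w => [|v [|]] //= _ _; rewrite -/(pad m v) ceps_pad linearZ /= flin_delta //.
- case: w => [|v [|v' [|]]] //= _ _; rewrite -!/(pad m _) cjoin_pad !flin_map.
  by apply: eq_flin.
- move=> /and3P[wg wf /eqP gf] ws; rewrite IHf // flin_map flin_comp.
  apply: eq_flin_supported (size_sdenote wf ws) => u uf.
  by rewrite IHg // uf.
- move=> /andP[wf wg] ws; rewrite -!map_take -!map_drop wdim_pad linearZ /=.
  by rewrite flin_map_tmul IHf ?IHg // ?size_take_min ?size_drop ws; lia.
- by move=> _ _; rewrite linear0.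
- move=> /and3P[wf wg /and3P[/eqP ei _ _]] ws.
  by rewrite linearD /= IHf // IHg // -ei.
- by move=> wf ws; rewrite linearZ /= IHf.
Qed.

End PaddedOperations.

(** * The comparison map is a morphism of coalgebras *)

Section ProjectionCoalgebraMap.
Variables (K : comPzRingType) (R : realType) (T : topologicalType) (m : nat).
Variable k_gt0 : (0 < m.+1)%N.
Local Notation d1 := (dir1 k_gt0).
Local Notation proj := (@proj_simp R m.+1 k_gt0 T).
Local Notation f := (@proj_chain K R m.+1 k_gt0 T).
Implicit Types (x : multisimplex (sing R 1 T)) (v : seq nat).

Lemma top_cell_proj n : top_cell (proj_idx k_gt0 n) = pad m (iota 0 (n ord0).+1).
Proof.
rewrite /top_cell enum_ordSl /= ffunE /pad [_ == _]eqxx; congr cons.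
rewrite -map_comp -[in RHS](size_enum_ord m).
elim: (enum _) => //= i s ->; rewrite ffunE.
by rewrite (_ : _ == d1 = false) //; apply/eqP => /(congr1 val).
Qed.

Lemma cell_mmap_pad v j :
  cell_mmap m.+1 (pad m v) j = if j == d1 then v else [:: 0%N].
Proof.
rewrite ffunE; case: (unliftP ord0 j) => [i|] ->.
  have /negPf -> : lift ord0 i != d1 by apply/eqP => /(congr1 val).
  by rewrite /= nth_nseq ltn_ord.
by have /eqP -> : ord0 = d1 by exact: val_inj.
Qed.

(** Pulling back along v and projecting commute; if v is not a face of the source of x,
its padding is not one of the source of the image either, and both sides vanish. *)
Lemma char_map_proj x v :
  f (char_map K x (cell_mmap 1 (pad 0 v))) =
  char_map K (proj x) (cell_mmap m.+1 (pad m v)).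
Proof.
have cell1 j : cell_mmap 1 (pad 0 v) j = v by rewrite ffunE (ord1 j).
have [[n h]|nh] := pselect (exists n, mhom n (tag x) (cell_mmap 1 (pad 0 v))).
  have h' : mhom (proj_idx k_gt0 n) (proj_idx k_gt0 (tag x)) (cell_mmap m.+1 (pad m v)).
    apply/forallP => j; rewrite cell_mmap_pad !ffunE; case: (eqVneq j d1) => // _.
    by have /forallP/(_ ord0) := h; rewrite cell1.
  rewrite (char_mapE K h) (char_mapE (x := proj x) K h') proj_chain_ngen; congr ngen.
  apply: sing_eq => // t u tu; rewrite ev_proj.
  rewrite -[LHS]/(ev x (prod_simplex_map (tag x) (cell_mmap 1 (pad 0 v)) (pi1 t))).
  rewrite -[RHS]/(ev x (pi1 (prod_simplex_map (proj_idx k_gt0 (tag x))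
    (cell_mmap m.+1 (pad m v)) u))).
  apply: ev_congr => j c.
  rewrite crd_prod_simplex_map // !crd_pi1 crd_prod_simplex_map // tu.
  by rewrite cell1 cell_mmap_pad eqxx.
rewrite !char_map0 => [|n|n]; first exact: linear0.
  apply/negP => h; apply: nh; exists ([ffun=> n d1] : {ffun 'I_1 -> nat}).
  apply/forallP => j; have /forallP/(_ d1) := h.
  by rewrite cell_mmap_pad eqxx cell1 !ffunE eqxx (ord1 j).
by apply/negP => h; apply: nh; exists n.
Qed.

Lemma proj_chain_umop r d (p : UM K r d) (c : chain (nchains K (sing R 1 T))) :
  nchains_op p (f c) = tpow (fun b => f (fdelta b)) (nchains_op p c).
Proof.
have lf : linear f by exact: flin_linear.
move: c; apply: eq_linear => [||b].
- by apply: comp_linear; [exact: flin_linear | exact: lf].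
- by apply: comp_linear; [exact: tpow_linear | exact: flin_linear].
have -> : f (fdelta b) = ngen K (proj (nval b)) by rewrite -proj_chain_ngen ngen_nval.
case: (ngenP (proj (nval b))) => [[b' e]|/degenerate_proj db]; last first.
  by exfalso; case: b db => x /= /asboolPn.
rewrite -e ngen_nval /nchains_op !flin_delta e.
case: (repr p) => t /= /and4P[wt /eqP ti _ _].
rewrite top_cell_proj tpow_comp.
have -> : top_cell (tag (nval b)) = pad 0 (iota 0 (tag (nval b) ord0).+1).
  by rewrite /top_cell enum_ordSl enum_ord0.
rewrite -[[:: pad m _]]/(map (pad m) [:: _]) -[[:: pad 0 _]]/(map (pad 0) [:: _]).
rewrite !mdenote_pad ?ti // !tpow_map.
by apply: eq_tpow => v; rewrite -(linear_flin _ lf) char_map_proj.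
Qed.

End ProjectionCoalgebraMap.

Theorem theorem3p4p1 (K : comPzRingType) (R : realType) (k : nat)
    (k_gt0 : (0 < k)%N) (T : topologicalType) :
  @umcoalg_quasi_iso K (sing_chains K R 1 T) (sing_chains K R k T)
    (@proj_chain K R k k_gt0 T).
Proof.
split; last exact: proj_chain_quasi_iso.
split; first exact: proj_chain_map.
case: k k_gt0 => // m k_gt0 r d p c; exact: proj_chain_umop.
Qed.
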